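(* Let $N\ge 2$ be an integer and let $t_1\cdots t_p\in\{0,1,\dots,N-1\}^p$ ($p\ge1$) be a block with $t_p<N-1$. Then $t_1\cdots t_p$ is an admissible block if and only if there exist bases $\beta_L,\beta_U\in[G_N,N)$ such that $(\alpha_i(\beta_L))=(t_1\cdots t_p)^\infty$ and $(\alpha_i(\beta_U))=(\theta_i(t_1\cdots t_p^+))$. Moreover, in this case $\beta_L<\beta_U$, the number $\beta_L$ is algebraic, and $\beta_U$ is transcendental.
   Context: Fix an integer $N\ge 2$. Blocks of equal length and infinite sequences over $\{0,1,\dots,N-1\}$ are compared lexicographically. For a digit $c$, $\overline{c}:=N-1-c$, and $\overline{c_1c_2\cdots}:=\overline{c_1}\,\overline{c_2}\cdots$ for blocks and sequences. For a block with last digit $c_p<N-1$, $c_1\cdots c_p^+:=c_1\cdots c_{p-1}(c_p+1)$. $(c_1\cdots c_p)^\infty$ denotes the periodic sequence repeating the block. $G_N:=k+1$ if $N=2k+1$, and $G_N:=\frac{k+\sqrt{k^2+4k}}{2}$ if $N=2k$. Quasi-greedy expansion: for $\beta\in(1,N]$, $(\alpha_i(\beta))_{i\ge1}$ is the quasi-greedy $\beta$-expansion of $1$, defined recursively: $\alpha_n(\beta)$ is the largest element of $\{0,\dots,N-1\}$ such that $\sum_{i=1}^{n}\alpha_i(\beta)\beta^{-i}<1$. Admissible block: a block $t_1\cdots t_p\in\{0,\dots,N-1\}^p$ is admissible if $t_p<N-1$ and for every $1\le i\le p$: $\overline{t_1\cdots t_p}\le t_i\cdots t_pt_1\cdots t_{i-1}$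 and $t_i\cdots t_p^+\,\overline{t_1\cdots t_{i-1}}\le t_1\cdots t_p^+$. Generalized Thue-Morse sequence: for a block with $t_p<N-1$, $(\theta_i)=(\theta_i(t_1\cdots t_p^+))$ is defined by $\theta_1\cdots\theta_p=t_1\cdots t_p^+$ and, for $m\ge0$, $\theta_{2^mp+1}\cdots\theta_{2^{m+1}p}=\overline{\theta_1\cdots\theta_{2^mp}}\,^+$. *)

(* Defs.v *)
From mathcomp Require Import all_boot all_order all_algebra.
From mathcomp Require Import reals.

Set Implicit Arguments.
Unset Strict Implicit.
Unset Printing Implicit Defensive.

Import Order.TTheory GRing.Theory Num.Theory.

(* A block c_1 ... c_p is a [seq nat] and an infinite sequence c_1 c_2 ... is a
   function [nat -> nat].  Both are indexed from 0: entry [i] is c_{i+1}. *)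

Local Open Scope nat_scope.

(* [N.-1 - c] is truncated subtraction, hence meaningful only for c < N. *)
Definition reflection (N : nat) (s : seq nat) : seq nat :=
  [seq N.-1 - c | c <- s].

Definition block_plus (s : seq nat) : seq nat :=
  set_nth 0 s (size s).-1 (last 0 s).+1.

Definition lexle (s t : seq nat) : bool :=
  ((s : seqlexi nat) <=
   (t : seqlexi nat))%O.

(* With i counted from 0, [drop i t] is t_{i+1} ... t_p and [take i t] is
   t_1 ... t_i. *)
Definition admissible (N : nat) (t : seq nat) : Prop :=
  last 0 t < N.-1 /\
  forall i, i < size t ->
    lexle (reflection N t) (drop i t ++ take i t) /\
    lexle (drop i (block_plus t) ++ reflection N (take i t)) (block_plus t).

Definition periodic (t : seq nat) : nat -> nat :=
  fun i => nth 0 t (i %% size t).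

(* theta_1 ... theta_{2^m p} for the generating block [u] = t_1 ... t_p^+. *)
Fixpoint theta_block (N : nat) (u : seq nat) (m : nat) : seq nat :=
  if m is m'.+1 then
    theta_block N u m' ++ block_plus (reflection N (theta_block N u m'))
  else u.

(* The block [theta_block N u i] has length 2^i * p > i, and each of these
   blocks is a prefix of the next one. *)
Definition theta (N : nat) (u : seq nat) : nat -> nat :=
  fun i => nth 0 (theta_block N u i) i.

Local Open Scope ring_scope.

Definition block_value (R : realType) (beta : R) (s : seq nat) : R :=
  \sum_(i < size s) (nth 0%N s i)%:R / beta ^+ i.+1.

(* The digit 0 always satisfies the constraint, so that the default value 0 of
   [\max] is harmless. *)
Fixpoint quasi_greedy_prefix (R : realType) (N : nat) (beta : R) (n : nat) :
    seq nat :=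
  if n is n'.+1 then
    let s := quasi_greedy_prefix N beta n' in
    rcons s (\max_(d < N | (block_value beta (rcons s d) < 1)%R) d)%N
  else [::].

Definition quasi_greedy (R : realType) (N : nat) (beta : R) : nat -> nat :=
  fun i => nth 0%N (quasi_greedy_prefix N beta i.+1) i.

Definition GN (R : realType) (N : nat) : R :=
  let k := (N./2)%:R in
  if odd N then k + 1 else (k + Num.sqrt (k ^+ 2 + 4 * k)) / 2.

Definition algebraic (R : realType) (x : R) : Prop :=
  algebraicOver (ratr : rat -> R) x.

Definition transcendental (R : realType) (x : R) : Prop := ~ algebraic x.

(* Main.v *)
Require Import Defs.
From mathcomp Require Import all_boot all_order all_algebra.
From mathcomp Require Import boolp classical_sets reals.
From mathcomp Require Import zify ring lra.

Set Implicit Arguments.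
Unset Strict Implicit.
Unset Printing Implicit Defensive.

Import Order.TTheory GRing.Theory Num.Theory.
Local Open Scope ring_scope.

(** A sequence [a] is the quasi-greedy expansion of 1 in base [b] iff all its
    scaled remainders [remainder a b n] lie in ]0, 1] ([quasi_greedyP]). Such a
    sequence is lexicographically at least each of its shifts
    ([expansion_shiftle]). Conversely, a sequence with this property that is
    moreover at most each of its shifts after reflection of the digits, and is not
    constantly [N - 1], is the expansion for some base in [[G_N, N)]
    ([exists_base]): an infimum of bases works, and the reflection property forces
    the expansion of [G_N] if the infimum is [G_N] itself.

    If [t] is admissible, the periodic sequence and theta have both properties.
    For theta one shows that doubling a block by its incremented reflection
    preserves the order relations between its suffixes and prefixes
    ([block_order_double]). Conversely, the shift property of theta contains the
    admissibility conditions, with one exception, where the reflection of a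
    rotation of [t] is the incremented block; that exception contradicts
    [G_N <= betaL] ([no_self_reflection]). The two expansions differ first at the
    last digit of [t], which orders the bases, and periodicity makes [betaL] a
    root of a monic rational polynomial ([periodic_base_algebraic]).

    For the transcendence of [betaU] put [x = betaU^-1] and [y = x ^+ p]. Centering
    the digits at [(N - 1) / 2] turns reflection into a sign, so that the recursive
    definition of theta becomes a product: up to elementary terms, the series of
    theta at [x] is a polynomial in [x] times the Thue-Morse product
    [W = (1 - y) (1 - y^2) (1 - y^4) ...] ([centered_sum_tm]). If [betaU] were
    algebraic, then so would be [y] and, as [betaU <> N], also [W]. Mahler's method
    excludes this ([tm_prod_limit_transcendental]). Linear algebra provides an
    integer polynomial of degree [n] in [z] and in the product function [F z] that
    vanishes at 0 to order [n ^ 2]. Since [F z = (1 - z) F (z ^ 2)], its values at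
    the points [y ^+ (2 ^ k)] are, up to a power of a partial product, polynomials
    of degree [O (n 2^k)] in [y] and [W]. Their absolute values are at most about
    [y ^+ (n ^ 2 2^k)], and infinitely many of them are nonzero
    ([mahler_independent]); for large [n] this violates Liouville's inequality
    ([liouville]). *)

(** * Finitely generated modules of real numbers and Liouville's inequality *)

Section AlgebraicLattice.
Variable R : realFieldType.
Implicit Types (x y w r s : R).

Notation ratmx := (map_mx (ratr : rat -> R)).

(** Row vectors encode finite families of reals; the matrix acts on the right,
    so [v *m A = x *: v] says that the Q-span of the family is stable under
    multiplication by [x]. *)
Definition rat_acts n (v : 'rV[R]_n) x :=
  exists A : 'M[rat]_n, v *m ratmx A = x *: v.

Lemma rat_acts_family (I : finType) (f : I -> R) x :
  (forall j, exists c : I -> rat, x * f j = \sum_i f i * ratr (c i)) ->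
  rat_acts (\row_(e < #|I|) f (enum_val e)) x.
Proof.
move=> /fin_all_exists[c cP].
exists (\matrix_(i, j) c (enum_val j) (enum_val i)).
apply/rowP=> j; rewrite !mxE cP (reindex _ (onW_bij _ (@enum_val_bij I))) /=.
by apply: eq_bigr => i _; rewrite !mxE.
Qed.

(** A monic relation of degree [n + 1] rewrites the top power [x ^+ n.+1] in
    terms of the lower ones. *)
Lemma algebraic_powers x : algebraicOver (ratr : rat -> R) x ->
  exists n, forall i : 'I_n.+1, exists c : 'I_n.+1 -> rat,
    x * x ^+ i = \sum_(j < n.+1) x ^+ j * ratr (c j).
Proof.
move/integral_algebraic=> [p mon_p px0].
have sp : (1 < size p)%N.
  rewrite ltnNge; apply/negP=> /size1_polyC p0.
  move: px0 mon_p; rewrite p0 map_polyC rootC fmorph_eq0 => /eqP->.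
  by rewrite monicE lead_coefC eq_sym oner_eq0.
case sz: (size p) sp => [|[|n]] // _; exists n => i.
have [lt_in|] := ltnP i n.
  have lt' : (i.+1 < n.+1)%N by [].
  exists (fun j => (j == Ordinal lt')%:R).
  rewrite (bigD1 (Ordinal lt')) //= eqxx rmorph1 mulr1 exprS big1 ?addr0 //.
  by move=> j /negbTE->; rewrite rmorph0 mulr0.
move=> le_ni; have -> : i = n :> nat by apply/eqP; rewrite eqn_leq le_ni -ltnS ltn_ord.
exists (fun j => - p`_j).
have:= px0; rewrite /root horner_coef size_map_poly sz big_ord_recr /= coef_map /=.
have -> : p`_n.+1 = 1 by move: mon_p; rewrite monicE lead_coefE sz => /eqP.
rewrite rmorph1 mul1r -exprS addrC addr_eq0 => /eqP->.
rewrite -sumrN; apply: eq_bigr => j _.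
by rewrite rmorphN mulrN coef_map mulrC.
Qed.

(** The monomials [x ^+ i * w ^+ j] of bounded degrees span a Q-space that is
    stable under multiplication by both [x] and [w]. *)
Lemma algebraic_pair_acts x w :
    algebraicOver (ratr : rat -> R) x -> algebraicOver (ratr : rat -> R) w ->
  exists n (v : 'rV[R]_n), [/\ v != 0, rat_acts v x & rat_acts v w].
Proof.
move=> /algebraic_powers[m xP] /algebraic_powers[l wP].
pose f (ij : 'I_m.+1 * 'I_l.+1) := x ^+ ij.1 * w ^+ ij.2.
exists #|{: 'I_m.+1 * 'I_l.+1}|, (\row_e f (enum_val e)); split.
- apply/eqP=> /rowP/(_ (enum_rank (ord0, ord0))).
  by rewrite !mxE enum_rankK /f !expr0 mulr1 => /eqP; rewrite oner_eq0.
- apply: rat_acts_family => -[i j]; have [c cP] := xP i.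
  exists (fun ij => c ij.1 * (ij.2 == j)%:R); rewrite /f /= mulrA cP.
  rewrite -(pair_bigA _ (fun (i0 : 'I_m.+1) (j0 : 'I_l.+1) =>
    x ^+ i0 * w ^+ j0 * ratr (c i0 * (j0 == j)%:R))).
  rewrite mulr_suml; apply: eq_bigr => i0 _.
  rewrite (bigD1 j) //= eqxx mulr1 [X in _ = _ + X]big1 ?addr0; first by rewrite mulrAC.
  by move=> j0 /negbTE->; rewrite mulr0 rmorph0 mulr0.
- apply: rat_acts_family => -[i j]; have [c cP] := wP j.
  exists (fun ij => c ij.2 * (ij.1 == i)%:R); rewrite /f /= mulrCA cP.
  rewrite -(pair_bigA _ (fun (i0 : 'I_m.+1) (j0 : 'I_l.+1) =>
    x ^+ i0 * w ^+ j0 * ratr (c j0 * (i0 == i)%:R))).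
  rewrite (bigD1 i) //= [X in _ = _ + X]big1 ?addr0; last first.
    by move=> i0 /negbTE->; rewrite big1 // => j0 _; rewrite mulr0 rmorph0 mulr0.
  by rewrite mulr_sumr; apply: eq_bigr => j0 _; rewrite eqxx mulr1 mulrA.
Qed.

Definition rat_free n (v : 'rV[R]_n) :=
  forall u : 'cV[rat]_n, v *m ratmx u = 0 -> u = 0.

Lemma drop_dependent n (v : 'rV[R]_n.+1) (u : 'cV[rat]_n.+1) i0 :
    v *m ratmx u = 0 -> u i0 0 != 0 ->
  exists (E : 'M[rat]_(n, n.+1)), col' i0 v *m ratmx E = v.
Proof.
move=> vu u0.
exists (\matrix_(k, j) if unlift i0 j is Some k' then (k == k')%:R
        else - u (lift i0 k) 0 / u i0 0).
apply/rowP=> j; rewrite !mxE; case: (unliftP i0 j) => [k ->|->].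
  rewrite (bigD1 k) //= !mxE liftK eqxx rmorph1 mulr1 big1 ?addr0 //.
  by move=> k' /negbTE k'k; rewrite !mxE liftK k'k rmorph0 mulr0.
have/rowP/(_ 0) := vu; rewrite !mxE (bigD1_ord i0) //= mxE => /eqP.
have u0' : (ratr (u i0 0) : R) != 0 by rewrite fmorph_eq0.
rewrite addr_eq0 => /eqP vi0; apply: (mulIf u0'); rewrite vi0 mulr_suml -sumrN.
apply: eq_bigr => k _; rewrite !mxE unlift_none -mulrA -rmorphM divfK //.
by rewrite rmorphN mulrN.
Qed.

(** A Q-linear relation between the entries expresses one of them through the
    others; deleting that entry keeps the span, hence its stability. Repeating
    this ends with a basis. Independence is what later makes the determinant of
    a nonzero multiplication nonzero. *)
Lemma minimal_acts n (v : 'rV[R]_n) x w :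
    v != 0 -> rat_acts v x -> rat_acts v w ->
  exists n' (v' : 'rV[R]_n'),
    [/\ v' != 0, rat_free v', rat_acts v' x & rat_acts v' w].
Proof.
elim: n v => [v|n IHn v] v0; first by rewrite thinmx0 eqxx in v0.
move=> xv wv; have [fv|] := pselect (rat_free v); first by exists n.+1, v.
move=> /existsNP[u /not_implyP[vu /eqP/cV0Pn[i0 ui0]]].
have [E vE] := drop_dependent vu ui0.
have [S vS] : exists S : 'M[rat]_(n.+1, n), col' i0 v = v *m ratmx S.
  exists (\matrix_(j, k) (j == lift i0 k)%:R); apply/rowP=> k; rewrite !mxE.
  rewrite (bigD1 (lift i0 k)) //= !mxE eqxx rmorph1 mulr1 big1 ?addr0 //.
  by move=> j /negbTE jk; rewrite !mxE jk rmorph0 mulr0.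
have act y : rat_acts v y -> rat_acts (col' i0 v) y.
  move=> [A vA]; exists (E *m A *m S).
  by rewrite !map_mxM /= !mulmxA vE vA -scalemxAl -vS.
apply: (IHn (col' i0 v)); [|exact: act..].
by apply: contra_neq v0 => v0; rewrite -vE v0 mul0mx.
Qed.

End AlgebraicLattice.

Lemma common_denominator (I : finType) (f : I -> rat) :
  exists2 d : nat, (0 < d)%N & forall i, exists m : int, d%:R * f i = m%:~R.
Proof.
exists `|(\prod_i denq (f i))%R|%N.
  by rewrite absz_gt0; apply/prodf_neq0 => i _; rewrite denq_neq0.
move=> i; exists ((\prod_(j | j != i) denq (f j)) * numq (f i)).
rewrite natr_absz ger0_norm; last by apply: prodr_ge0 => j _; rewrite denq_ge0.
rewrite (bigD1 i) //= mulrC !rmorphM /= mulrA -[X in X * _ * _]divq_num_den.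
by rewrite divfK ?intr_eq0 ?denq_neq0 // mulrC.
Qed.

Lemma det_colsum_le (R : realDomainType) n (A : 'M[R]_n) (c : R) :
  (forall j, \sum_i `|A i j| <= c) -> `|\det A| <= c ^+ n.
Proof.
elim: n A => [|n IHn] A cA; first by rewrite det_mx00 normr1 expr0.
rewrite (expand_det_col A ord0); apply: (le_trans (ler_norm_sum _ _ _)).
have c0 : 0 <= c by apply: le_trans (cA ord0); apply: sumr_ge0.
rewrite exprS; apply: (@le_trans _ _ (\sum_i `|A i ord0| * c ^+ n)); last first.
  by rewrite -mulr_suml ler_wpM2r ?exprn_ge0.
apply: ler_sum => i _; rewrite normrM ler_wpM2l // /cofactor normrM.
rewrite normrX normrN1 expr1n mul1r; apply: IHn => j.
apply: le_trans (cA (lift ord0 j)); rewrite [leRHS](bigD1_ord i) //=.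
rewrite -[leLHS]add0r lerD //; apply: ler_sum => k _.
by rewrite !mxE.
Qed.

Section IntegralAction.
Variables (R : realFieldType) (n : nat) (v : 'rV[R]_n).
Implicit Types (x r s c d : R).

Notation intmx := (map_mx (intr : int -> R)).

(** The integral counterpart of [rat_acts], with a bound [c] on the absolute
    column sums. Those bounds add and multiply along with the numbers, so [c]
    plays the part of the house of the algebraic integer [r]. *)
Definition int_acts r c := exists2 M : 'M[int]_n,
  v *m intmx M = r *: v & forall j, \sum_i `|(M i j)%:~R : R| <= c.

Lemma int_acts_le r c d : c <= d -> int_acts r c -> int_acts r d.
Proof. by move=> cd [M vM Mc]; exists M => // j; apply: le_trans cd. Qed.

Lemma int_acts_int (m : int) : int_acts m%:~R `|m%:~R|.
Proof.
exists m%:M; first by rewrite map_scalar_mx mul_mx_scalar.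
move=> j; rewrite (bigD1 j) //= mxE eqxx mulr1n big1 ?addr0 // => i /negbTE ij.
by rewrite mxE ij mulr0n normr0.
Qed.

Lemma int_actsD r s c d : int_acts r c -> int_acts s d -> int_acts (r + s) (c + d).
Proof.
move=> [M vM Mc] [L vL Ld]; exists (M + L).
  by rewrite map_mxD mulmxDr vM vL scalerDl.
move=> j; apply: le_trans (lerD (Mc j) (Ld j)); rewrite -big_split /=.
by apply: ler_sum => i _; rewrite mxE rmorphD ler_normD.
Qed.

Lemma int_actsM r s c d : int_acts r c -> int_acts s d -> int_acts (r * s) (c * d).
Proof.
move=> [M vM Mc] [L vL Ld]; exists (M *m L).
  by rewrite map_mxM mulmxA vM -scalemxAl vL scalerA.
move=> j; have c0 : 0 <= c by apply: le_trans (Mc j); apply: sumr_ge0.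
apply: (@le_trans _ _ (\sum_i \sum_k `|(M i k)%:~R : R| * `|(L k j)%:~R : R|)).
  apply: ler_sum => i _; rewrite mxE rmorph_sum; apply: le_trans (ler_norm_sum _ _ _) _.
  by apply: ler_sum => k _; rewrite rmorphM normrM.
rewrite exchange_big /=; apply: (@le_trans _ _ (\sum_k c * `|(L k j)%:~R : R|)).
  by apply: ler_sum => k _; rewrite -mulr_suml ler_wpM2r.
by rewrite -mulr_sumr ler_wpM2l.
Qed.

Lemma int_actsX r c k : int_acts r c -> int_acts (r ^+ k) (c ^+ k).
Proof.
move=> rc; elim: k => [|k IHk]; last by rewrite !exprS; apply: int_actsM.
by rewrite !expr0; have := int_acts_int 1; rewrite normr1.
Qed.

Lemma int_acts_sum (I : Type) (l : seq I) (P : pred I) (r c : I -> R) :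
  (forall i, P i -> int_acts (r i) (c i)) ->
  int_acts (\sum_(i <- l | P i) r i) (\sum_(i <- l | P i) c i).
Proof.
move=> rc; elim/big_ind2: _ => //; last by move=> *; apply: int_actsD.
by have := int_acts_int 0; rewrite normr0.
Qed.

Lemma rat_int_acts x : rat_acts v x ->
  exists2 d : nat, (0 < d)%N & exists c, int_acts (d%:R * x) c.
Proof.
move=> [A vA].
have [d d0 /fin_all_exists[M dA]] :=
  common_denominator (fun ij : 'I_n * 'I_n => A ij.1 ij.2).
exists d => //; pose L : 'M[int]_n := \matrix_(i, j) M (i, j).
exists (\sum_j \sum_i `|(L i j)%:~R : R|), L; last first.
  move=> j; rewrite [leRHS](bigD1 j) //= lerDl; apply: sumr_ge0 => k _.
  exact: sumr_ge0.
rewrite -scalerA -vA scalemxAr; congr (_ *m _); apply/matrixP=> i j.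
rewrite !mxE; have /(congr1 (ratr : rat -> R)) := dA (i, j).
by rewrite rmorphM /= ratr_nat ratr_int.
Qed.

End IntegralAction.

(** The integer matrix [M] of a nonzero multiplication by [r] on an independent
    family is invertible, so its determinant has absolute value at least 1.
    Multiplying [v *m M = r *: v] by the adjugate bounds the determinant by
    [`|r|] times cofactors, which are at most [c ^+ n'] by
    [det_colsum_le]. *)
Lemma liouville (R : realFieldType) n (v : 'rV[R]_n) : v != 0 -> rat_free v ->
  exists2 K, 0 < K &
    exists e : nat, forall r c, r != 0 -> int_acts v r c ->
      1 <= K * `|r| * c ^+ e.
Proof.
move=> v0 fv; have /rV0Pn[i0 vi0] := v0.
case: n v v0 fv i0 vi0 => [|n'] v' v0 fv i0 vi0; first by case: i0 vi0.
exists ((\sum_i `|v' 0 i|) / `|v' 0 i0|).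
  rewrite divr_gt0 ?normr_gt0 // (bigD1 i0) //= ltr_pwDl ?normr_gt0 //.
  exact: sumr_ge0.
exists n' => r c r0 [M vM Mc].
have detM0 : \det M != 0.
  apply/negP=> /eqP detM0.
  pose Mq := map_mx (intr : int -> rat) M.
  have : \det Mq^T == 0 by rewrite det_tr det_map_mx detM0.
  case/det0P=> u u0 uM; move/eqP: u0; apply; apply: trmx_inj; rewrite trmx0.
  apply: fv; apply: (scalerI r0); rewrite scaler0 scalemxAl -vM -mulmxA.
  have -> : map_mx (intr : int -> R) M = map_mx ratr Mq.
    by apply/matrixP=> i j; rewrite !mxE ratr_int.
  by rewrite -map_mxM -[Mq]trmxK -trmx_mul uM trmx0 map_mx0 mulmx0.
have: 1 <= `|(\det M)%:~R : R|.
  by rewrite -intr_norm -[1]/(1%:~R) ler_int -gtz0_ge1 normr_gt0.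
set Mr := map_mx (intr : int -> R) M in vM.
have -> : (\det M)%:~R = \det Mr :> R by rewrite det_map_mx.
have /rowP/(_ i0) : r *: (v' *m \adj Mr) = \det Mr *: v'.
  by rewrite scalemxAl -vM -mulmxA mul_mx_adj mul_mx_scalar.
rewrite !mxE => /(congr1 Num.norm); rewrite !normrM => detE le1.
rewrite -(ler_pM2r (_ : 0 < `|v' 0 i0|)) ?normr_gt0 // mul1r in le1.
rewrite -mulrA mulrAC ler_pdivlMr ?normr_gt0 // mul1r mulrCA.
apply: (le_trans le1); rewrite -detE; rewrite ler_wpM2l // mulr_suml.
apply: le_trans (ler_norm_sum _ _ _) _; apply: ler_sum => i _.
rewrite normrM ler_wpM2l // mxE /cofactor normrM normrX normrN1 expr1n mul1r.
apply: det_colsum_le => j; apply: le_trans (Mc (lift i j)).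
rewrite [leRHS](bigD1_ord i0) //= -[leLHS]add0r lerD //.
by apply: ler_sum => k _; rewrite !mxE.
Qed.

(** * Mahler's method: linear algebra and the zero estimate *)

(** More unknowns than homogeneous equations: a kernel vector over the rationals,
    with its denominators cleared. *)
Lemma integer_relation (I : finType) (L : nat) (g : I -> nat -> int) :
    (L < #|I|)%N ->
  exists2 c : I -> int, exists i, c i != 0 &
    forall h, (h < L)%N -> \sum_i c i * g i h = 0.
Proof.
move=> ltLI.
pose M : 'M[rat]_(#|I|, L) := \matrix_(i, h) (g (enum_val i) h)%:~R.
have: kermx M != 0.
  rewrite kermx_eq0 -row_leq_rank -ltnNge; apply: leq_ltn_trans ltLI.
  exact: rank_leq_col.
case/rowV0Pn=> u /sub_kermxP uM /rV0Pn[i0 ui0].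
have [d d0 /fin_all_exists[c cP]] := common_denominator (fun i => u 0 i).
exists (fun i => c (enum_rank i)).
  exists (enum_val i0); rewrite enum_valK; apply: contra_neq ui0 => ci0.
  have /eqP := cP i0; rewrite ci0 mulf_eq0 pnatr_eq0.
  by rewrite eqn0Ngt d0 => /eqP.
move=> h ltL; have /rowP/(_ (Ordinal ltL)) := uM; rewrite !mxE => uM0.
apply/eqP; rewrite -(@intr_eq0 rat) rmorph_sum.
rewrite (reindex _ (onW_bij _ (@enum_val_bij I))) /=.
apply/eqP; rewrite -[RHS](mulr0 d%:R) -[in RHS]uM0 mulr_sumr.
apply: eq_bigr => i _.
by rewrite rmorphM /= enum_valK -cP mxE mulrA.
Qed.

Section MahlerIndependence.
Variable R : realFieldType.
Implicit Types p q u v : {poly R}.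

(** The substitution of ['X^2] for ['X] is unramified at 1, hence preserves the
    order of vanishing there; the factor [(1 - 'X) ^+ s.+1] makes the two sides
    vanish at 1 to different orders. *)
Lemma mahler_order_at_1 u v s :
    (u \Po 'X^2) * v = u * (v \Po 'X^2) * (1 - 'X) ^+ s.+1 ->
  (u == 0) || (v == 0).
Proof.
move=> E; apply: contraT; rewrite negb_or => /andP[u0 v0].
have [m [u1]] := multiplicity_XsubC u 1; rewrite u0 /= => u11 Eu.
have [r [v1]] := multiplicity_XsubC v 1; rewrite v0 /= => v11 Ev.
have sqX k : ('X - 1%:P) ^+ k \Po 'X^2 = ('X + 1) ^+ k * ('X - 1%:P) ^+ k :> {poly R}.
  rewrite -exprMn rmorphXn /= comp_polyB comp_polyX comp_polyC; congr (_ ^+ _).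
  by rewrite polyC1; ring.
move: E; rewrite Eu Ev !comp_polyM !sqX.
set q1 := ('X - 1%:P) ^+ m; set q2 := ('X - 1%:P) ^+ r.
have q0 : q1 * q2 != 0 by rewrite mulf_neq0 // expf_neq0 // polyXsubC_eq0.
move=> E; have {E} : (q1 * q2) * ((u1 \Po 'X^2) * ('X + 1) ^+ m * v1) =
   (q1 * q2) * (u1 * ((v1 \Po 'X^2) * ('X + 1) ^+ r) * (1 - 'X) ^+ s.+1).
  by move: E; rewrite -!mulrA => E; ring: E.
move/(mulfI q0) => /(congr1 (horner_eval 1)); rewrite /horner_eval.
rewrite !(hornerM, horner_exp, hornerD, hornerX, horner_comp, hornerXn,
          hornerN, hornerC).
rewrite mulr1 subrr expr0n /= mulr0 => /eqP.
rewrite /root in u11 v11; rewrite !mulf_eq0 expf_eq0 -(natrD _ 1 1) pnatr_eq0.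
by rewrite andbF orbF (negbTE u11) (negbTE v11).
Qed.

Variables (z f : nat -> R).
Hypothesis z_sq : forall k, z k.+1 = z k ^+ 2.
Hypothesis z_inj : injective z.
Hypothesis f_eq : forall k, f k = (1 - z k) * f k.+1.
Hypothesis f_neq0 : forall k, f k != 0.

Lemma poly_eq0_infinite_roots p k0 : (forall k, (k0 <= k)%N -> p.[z k] = 0) -> p = 0.
Proof.
move=> pz; apply/eqP; apply: contraT => p0.
have rts : all (root p) (map z (iota k0 (size p))).
  apply/allP=> _ /mapP[k /[!mem_iota] /andP[k0k _] ->].
  by rewrite /root pz.
have uz : uniq (map z (iota k0 (size p))) by rewrite map_inj_uniq // iota_uniq.
by have := max_poly_roots p0 rts uz; rewrite size_map size_iota ltnn.
Qed.

(** Here [f k] stands for [F (z k)] with [F] a solution of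
    [F z = (1 - z) * F (z ^+ 2)], and only the points [z k] matter. Take a
    relation of least degree in [f]: substituting [k.+1] for [k] gives a second
    relation of that degree, and eliminating the top term leaves a shorter one,
    which is trivial. Its constant term forces the first or the last coefficient
    to vanish, by [mahler_order_at_1]; in the former case [f] divides out. *)
Lemma mahler_independent s (c : nat -> {poly R}) k0 :
    (forall k, (k0 <= k)%N -> \sum_(l < s.+1) (c l).[z k] * f k ^+ l = 0) ->
  forall l, (l <= s)%N -> c l = 0.
Proof.
elim: s c => [|s IHs] c rel.
  case=> // _; apply: (@poly_eq0_infinite_roots _ k0) => k /rel.
  by rewrite big_ord1 expr0 mulr1.
pose d l := (c s.+1 \Po 'X^2) * c l
            - c s.+1 * (c l \Po 'X^2) * (1 - 'X) ^+ (s.+1 - l).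
have rel_d l : (l <= s)%N -> d l = 0.
  apply: IHs => k k0k.
  have := rel k.+1 (leqW k0k); move/(congr1 ( *%R ((c s.+1).[z k] * (1 - z k) ^+ s.+1))).
  have := rel k k0k; move/(congr1 ( *%R (c s.+1).[z k ^+ 2])).
  rewrite !mulr0 !mulr_sumr => R1 R2.
  have: \sum_(l < s.+2) (d l).[z k] * f k ^+ l = 0.
    rewrite -[RHS](subrr 0) -[X in _ = X - _]R1 -[X in _ = _ - X]R2 -sumrB.
    apply: eq_bigr => l' _.
    rewrite /d hornerD hornerN !hornerM !horner_comp hornerXn horner_exp hornerD.
    rewrite hornerN hornerX hornerC z_sq mulrBl mulrA; congr (_ - _).
    have -> : (1 - z k) ^+ s.+1 = (1 - z k) ^+ (s.+1 - l') * (1 - z k) ^+ l'.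
      by rewrite -exprD subnK // -ltnS.
    by rewrite f_eq exprMn; ring.
  rewrite big_ord_recr /= [X in _ + X * _](_ : _ = 0) ?mul0r ?addr0 //.
  by rewrite /d subnn expr0 mulr1 mulrC subrr horner0.
have /eqP := rel_d 0%N isT; rewrite /d subn0 subr_eq0 => /eqP/mahler_order_at_1.
case/orP=> /eqP c0.
  have cl : forall l, (l <= s)%N -> c l = 0.
    by apply: IHs => k /rel; rewrite big_ord_recr /= c0 horner0 mul0r addr0.
  by move=> l; rewrite leq_eqVlt => /orP[/eqP->|/cl].
have cl : forall l, (l <= s)%N -> c l.+1 = 0.
  apply: (IHs (fun l => c l.+1)) => k /rel; rewrite big_ord_recl /= c0 horner0 mul0r add0r.
  move=> E; apply: (mulfI (f_neq0 k)); rewrite mulr0 -[RHS]E mulr_sumr.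
  by apply: eq_bigr => l _; rewrite /bump /= exprS; ring.
by case=> [|l] // /cl.
Qed.

End MahlerIndependence.

(** * The Thue-Morse product *)

(** Bernoulli's inequality for [a^-1]. *)
Lemma expr_small (R : archiRealFieldType) (a c : R) :
  0 < a < 1 -> exists n, forall k, (n <= k)%N -> c * a ^+ k < 1.
Proof.
move=> /andP[a0 a1]; have h0 : 0 < a^-1 - 1 by rewrite subr_gt0 invf_gt1.
pose n := Num.bound (Num.max c 0 / (a^-1 - 1)).
have n_gt : Num.max c 0 < n%:R * (a^-1 - 1).
  rewrite -ltr_pdivrMr //; apply: archi_boundP.
  by rewrite divr_ge0 ?le_max ?lexx ?orbT // ltW.
have bern k : 1 + k%:R * (a^-1 - 1) <= a^-1 ^+ k.
  elim: k => [|k IHk]; first by rewrite mul0r addr0 expr0.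
  rewrite exprS; apply: (le_trans _ (ler_wpM2l _ IHk)); last by rewrite invr_ge0 ltW.
  have : 0 <= k%:R * (a^-1 - 1) ^+ 2 :> R by rewrite mulr_ge0 // exprn_ge0 // ltW.
  by rewrite -natr1; nra.
exists n => k nk; rewrite -ltr_pdivlMr ?exprn_gt0 // mul1r -exprVn.
apply: lt_le_trans (bern k); apply: (@le_lt_trans _ _ (Num.max c 0)).
  by rewrite le_max lexx.
apply: (lt_le_trans n_gt); apply: (@le_trans _ _ (k%:R * (a^-1 - 1))).
  by rewrite ler_pM2r // ler_nat.
by rewrite lerDr.
Qed.

Lemma poly_small_at_0 (R : realFieldType) (p : {poly int}) (L : nat) :
    (forall h, (h < L)%N -> p`_h = 0) ->
  exists2 C : R, 0 <= C &
    forall z, 0 <= z <= 1 -> `|(map_poly intr p).[z]| <= C * z ^+ L.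
Proof.
move=> p0; exists (\sum_(i < size p) `|(p`_i)%:~R|); first exact: sumr_ge0.
move=> z /andP[z0 z1]; rewrite (@horner_coef_wide _ (size p)) ?size_poly //.
rewrite mulr_suml; apply: le_trans (ler_norm_sum _ _ _) _.
apply: ler_sum => i _; rewrite coef_map /= normrM.
have [/p0->|Li] := ltnP i L; first by rewrite normr0 !mul0r.
by rewrite ler_wpM2l // normrX ger0_norm // ler_wiXn2l.
Qed.

(** The partial products of the generating function of the Thue-Morse signs. *)
Definition tm_prod (R : pzRingType) (a : R) (m : nat) : R :=
  \prod_(j < m) (1 - a ^+ (2 ^ j)).

Lemma tm_prodS (R : pzRingType) (a : R) m :
  tm_prod a m.+1 = tm_prod a m * (1 - a ^+ (2 ^ m)).
Proof. by rewrite /tm_prod big_ord_recr. Qed.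

Lemma tm_prodD (R : comPzRingType) (a : R) k m :
  tm_prod a (k + m) = tm_prod a k * tm_prod (a ^+ (2 ^ k)) m.
Proof.
rewrite /tm_prod big_split_ord /=; congr (_ * _).
by apply: eq_bigr => j _; rewrite -exprM expnD.
Qed.

Section TmProdBounds.
Variables (R : realFieldType) (a : R).
Hypothesis a01 : 0 < a < 1.

Lemma expr_pow2_itv j : 0 < a ^+ (2 ^ j) < 1.
Proof.
have /andP[a0 a1] := a01; rewrite exprn_gt0 //= exprn_ilt1 ?ltW //.
by rewrite -lt0n expn_gt0.
Qed.

Lemma tm_prod_gt0 m : 0 < tm_prod a m.
Proof. by apply: prodr_gt0 => j _; rewrite subr_gt0; case/andP: (expr_pow2_itv j). Qed.

Lemma tm_prod_le m k : (m <= k)%N -> tm_prod a k <= tm_prod a m.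
Proof.
move=> /subnK<-; elim: (k - m)%N => // i IHi; apply: le_trans IHi.
rewrite addSn tm_prodS ger_pMr ?tm_prod_gt0 //.
by rewrite gerBl exprn_ge0 // ltW //; case/andP: a01.
Qed.

Lemma tm_prod_le1 m : tm_prod a m <= 1.
Proof. by have := tm_prod_le (leq0n m); rewrite /tm_prod [leRHS]big_ord0. Qed.

End TmProdBounds.

(** The auxiliary polynomial of Mahler's method: there are [(n + 1) ^ 2]
    coefficients to choose and only [n ^ 2 + 1] of them have to be cancelled, so
    that a polynomial of degree [n] in each of [z] and [tm_prod z m] can vanish
    at 0 to an order that is quadratic in [n]. *)
Lemma auxiliary_poly (R : realFieldType) (n m : nat) : (0 < n)%N ->
  exists2 p : 'I_n.+1 * 'I_n.+1 -> int, exists il, p il != 0 &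
  exists2 C : R, 0 <= C & forall z, 0 <= z <= 1 ->
    `|\sum_il (p il)%:~R * z ^+ il.1 * tm_prod z m ^+ il.2| <= C * z ^+ (n * n).+1.
Proof.
move=> n0; pose q (il : 'I_n.+1 * 'I_n.+1) : {poly int} := 'X^(il.1) * tm_prod 'X m ^+ il.2.
have [|p p0 rel] := @integer_relation _ (n * n).+1 (fun il h => (q il)`_h).
  by rewrite card_prod card_ord; nia.
exists p => //.
have [|C C0 small] := @poly_small_at_0 R (\sum_il p il *: q il) (n * n).+1.
  move=> h hL; rewrite coef_sum -[RHS](rel h hL).
  by apply: eq_bigr => il _; rewrite coefZ.
exists C => // z /small; rewrite rmorph_sum /= horner_sum.
suff -> : \sum_il (map_poly intr (p il *: q il)).[z] =
  \sum_il (p il)%:~R * z ^+ il.1 * tm_prod z m ^+ il.2 by [].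
apply: eq_bigr => il _; rewrite map_polyZ hornerZ rmorphM /= hornerM -mulrA.
congr (_ * (_ * _)); first by rewrite map_polyXn hornerXn.
rewrite rmorphXn horner_exp /= rmorph_prod horner_prod; congr (_ ^+ _).
apply: eq_bigr => j _; rewrite rmorphB /= rmorph1 map_polyXn.
by rewrite hornerD hornerN hornerXn hornerC.
Qed.

(** * Mahler's method: transcendence of the Thue-Morse product *)

Lemma normXB_le (R : realFieldType) (x y B : R) l n :
    `|x| <= B -> `|y| <= B -> 1 <= B -> (l <= n)%N ->
  `|x ^+ l - y ^+ l| <= `|x - y| * (n%:R * B ^+ n).
Proof.
move=> xB yB B1 ln; have B0 : 0 <= B by apply: le_trans B1.
rewrite subrXX normrM ler_wpM2l //.
apply: le_trans (ler_norm_sum _ _ _) _.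
apply: (@le_trans _ _ (\sum_(i < l) B ^+ n)); last first.
  rewrite sumr_const card_ord -[leLHS]mulr_natl ler_wpM2r ?ler_nat // exprn_ge0 //.
apply: ler_sum => i _; rewrite normrM !normrX.
apply: (@le_trans _ _ (B ^+ (l.-1 - i) * B ^+ i)).
  by apply: ler_pM; rewrite ?exprn_ge0 //; apply: lerXn2r; rewrite ?nnegrE.
by rewrite -exprD ler_weXn2l //; have := ltn_ord i; lia.
Qed.

Lemma addX_le (R : realDomainType) (x y : R) j :
  (0 < j)%N -> 0 <= x -> 0 <= y -> x ^+ j + y ^+ j <= (x + y) ^+ j.
Proof.
case: j => // j _ x0 y0; elim: j => [|j IHj]; first by rewrite !expr1.
rewrite [leRHS]exprS; apply: le_trans (ler_wpM2l (addr_ge0 x0 y0) IHj).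
have := mulr_ge0 x0 (exprn_ge0 j.+1 y0); have := mulr_ge0 y0 (exprn_ge0 j.+1 x0).
by rewrite !(exprS _ j.+1); lra.
Qed.

(** With [Q = 2 ^ k], the left-hand side is the total degree in [a] and [W] of a
    term of the auxiliary polynomial at [z k], multiplied by [tm_prod a k ^+ n]
    to clear the denominator of [f k ^+ l]. *)
Lemma exponent_le n i l Q : (i <= n)%N -> (l <= n)%N -> (0 < Q)%N ->
  (Q * i + l + Q.-1 * (n - l) <= 3 * (n * Q))%N.
Proof. by case: Q => // Q; nia. Qed.

(** [W] is the value at [a] of the infinite product, given through its rate of
    approximation; [f k] is then the value at [z k]. *)
Section MahlerMethod.
Variables (R : archiRealFieldType) (a W C : R).
Hypothesis a01 : 0 < a < 1.
Hypothesis W0 : W != 0.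
Hypothesis tm_limit : forall m, `|tm_prod a m - W| <= C * a ^+ (2 ^ m).

Let z k := a ^+ (2 ^ k).
Let f k := W / tm_prod a k.

Lemma limit_const_ge0 : 0 <= C.
Proof.
have /andP[a0 _] := a01; have := le_trans (normr_ge0 _) (tm_limit 0).
by rewrite expr1 pmulr_lge0.
Qed.

Lemma tm_prod_lower : exists2 dlt, 0 < dlt & forall k, dlt <= tm_prod a k.
Proof.
have W1 : 0 < `|W| / 2 by rewrite divr_gt0 ?normr_gt0.
exists (`|W| / 2) => // k.
have [n small] := expr_small (C / (`|W| / 2)) a01.
pose m := maxn n k; apply: le_trans (tm_prod_le a01 (leq_maxr n k)); rewrite -/m.
have m_lt : (m < 2 ^ m)%N by rewrite ltn_expl.
have := small (2 ^ m)%N (ltnW (leq_ltn_trans (leq_maxl n k) m_lt)).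
rewrite mulrAC ltr_pdivrMr // mul1r => lt1.
have : `|W| <= `|tm_prod a m| + `|tm_prod a m - W|.
  by rewrite -[X in `|X| <= _](subKr (tm_prod a m)) ler_normB.
rewrite (gtr0_norm (tm_prod_gt0 a01 m)) => le1.
by have := le_trans (tm_limit m) (ltW lt1); lra.
Qed.

Definition mahler_value n (p : 'I_n.+1 * 'I_n.+1 -> int) k : R :=
  \sum_il (p il)%:~R * z k ^+ il.1 * f k ^+ il.2.

(** The auxiliary polynomial is small at the polynomial [tm_prod]; replacing it
    by the true value [f k] costs [O (z k ^+ (2 ^ m))], which is harmless as
    soon as [2 ^ m] exceeds the order of vanishing. *)
Lemma mahler_value_le n (p : 'I_n.+1 * 'I_n.+1 -> int) (C0 : R) : 0 <= C0 ->
    (forall z, 0 <= z <= 1 ->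
      `|\sum_il (p il)%:~R * z ^+ il.1 * tm_prod z (n * n).+1 ^+ il.2|
        <= C0 * z ^+ (n * n).+1) ->
  exists2 C1, 0 <= C1 & forall k, `|mahler_value p k| <= C1 * z k ^+ (n * n).+1.
Proof.
move=> C00 aux; have [dlt d0 dP] := tm_prod_lower; have C_ge0 := limit_const_ge0.
set m := (n * n).+1 in aux *.
pose B := Num.max 1 (`|W| / dlt).
have B1 : 1 <= B by rewrite le_max lexx.
have S0 : 0 <= \sum_il `|(p il)%:~R : R| by apply: sumr_ge0.
have Bn0 : 0 <= n%:R * B ^+ n.
  by rewrite mulr_ge0 // exprn_ge0 // (le_trans _ B1).
exists (C0 + (\sum_il `|(p il)%:~R|) * (C / dlt * (n%:R * B ^+ n))).
  by rewrite addr_ge0 // mulr_ge0 // mulr_ge0 // divr_ge0 // ltW.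
move=> k; have /andP[z0 z1] := expr_pow2_itv a01 k; rewrite -/(z k) in z0 z1.
have Pk0 := tm_prod_gt0 a01 k.
have fB : `|f k| <= B.
  rewrite /f normrM normfV (gtr0_norm Pk0) le_max; apply/orP; right.
  by rewrite ler_wpM2l // lef_pV2.
have FB : `|tm_prod (z k) m| <= B.
  apply: le_trans B1; rewrite ger0_norm; first by apply: tm_prod_le1; rewrite z0.
  by apply/ltW/tm_prod_gt0; rewrite z0.
have fF : `|f k - tm_prod (z k) m| <= C / dlt * z k ^+ m.
  have -> : f k - tm_prod (z k) m = - (tm_prod a (k + m) - W) / tm_prod a k.
    by rewrite tm_prodD -/(z k) /f; field; rewrite gt_eqF.
  rewrite normrM normrN normfV (gtr0_norm Pk0) mulrAC.
  apply: ler_pM => //; rewrite ?invr_ge0 ?(ltW Pk0) //; last by rewrite lef_pV2.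
  apply: (le_trans (tm_limit _)); rewrite ler_wpM2l // expnD exprM -/(z k).
  by rewrite ler_wiXn2l ?ltW //; apply/ltnW/ltn_expl.
have zle : 0 <= z k <= 1 by rewrite !ltW.
have -> : mahler_value p k =
    \sum_il (p il)%:~R * z k ^+ il.1 * tm_prod (z k) m ^+ il.2
    + \sum_il (p il)%:~R * z k ^+ il.1 * (f k ^+ il.2 - tm_prod (z k) m ^+ il.2).
  by rewrite -big_split; apply: eq_bigr => il _; rewrite /= -mulrDr addrC subrK.
rewrite mulrDl; apply: (le_trans (ler_normD _ _)); apply: lerD; first exact: aux.
apply: (le_trans (ler_norm_sum _ _ _)); rewrite -[leRHS]mulrA mulr_suml.
apply: ler_sum => il _; rewrite !normrM -[leLHS]mulrA ler_wpM2l //.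
apply: (@le_trans _ _ `|f k ^+ il.2 - tm_prod (z k) m ^+ il.2|).
  by rewrite ler_piMl // normrX exprn_ile1 // ger0_norm // ltW.
have il2 : (il.2 <= n)%N by rewrite -ltnS.
by apply: (le_trans (normXB_le fB FB B1 il2)); rewrite mulrAC ler_wpM2r.
Qed.

Lemma pow2_orbit_inj : injective z.
Proof.
have /andP[a0 a1] := a01.
move=> j k /(ieexprIn a0 (negbT (lt_eqF a1)))/eqP.
by rewrite eqn_exp2l // => /eqP.
Qed.

Lemma mahler_value_neq0 n (p : 'I_n.+1 * 'I_n.+1 -> int) k0 :
  (exists il, p il != 0) -> exists2 k, (k0 <= k)%N & mahler_value p k != 0.
Proof.
move=> [[i l] pil]; apply: contrapT => /forall2NP vanish.
pose c l : {poly R} := \poly_(i < n.+1) (p (inord i, inord l))%:~R.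
have c0 : forall l, (l <= n)%N -> c l = 0.
  apply: (@mahler_independent _ z f _ pow2_orbit_inj _ _ _ _ k0).
  - by move=> k; rewrite /z expnS mulnC exprM.
  - move=> k; rewrite /f tm_prodS -/(z k); field.
    have /andP[_ z1] := expr_pow2_itv a01 k.
    by rewrite !gt_eqF ?tm_prod_gt0 // subr_gt0.
  - by move=> k; rewrite /f mulf_neq0 // invr_eq0 gt_eqF // tm_prod_gt0.
  move=> k k0k; have [//|/negP/negPn/eqP E0] := vanish k.
  rewrite -[RHS]E0 /mahler_value.
  have -> : \sum_il (p il)%:~R * z k ^+ il.1 * f k ^+ il.2 =
      \sum_i \sum_l (p (i, l))%:~R * z k ^+ i * f k ^+ l.
    by rewrite pair_bigA; apply: eq_bigr => -[].
  rewrite exchange_big; apply: eq_bigr => l' _.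
  rewrite horner_poly mulr_suml; apply: eq_bigr => i' _.
  by rewrite !inord_val.
have /polyP/(_ i) := c0 l (ltn_ord l); rewrite coef_poly coef0 ltn_ord !inord_val.
by move/eqP; rewrite intr_eq0 (negbTE pil).
Qed.

Hypothesis a_alg : algebraicOver (ratr : rat -> R) a.

(** If [W] were algebraic, [tm_prod a k ^+ n * mahler_value p k] would be an
    integral polynomial in [a] and [W] of degree [O (n * 2 ^ k)], so Liouville's
    inequality bounds it below by [lam ^- (n * 2 ^ k)] up to a constant, where
    [lam] depends on [a] and [W] only. *)
Lemma mahler_value_lower : algebraicOver (ratr : rat -> R) W ->
  exists2 lam : R, 1 <= lam &
  forall n (p : 'I_n.+1 * 'I_n.+1 -> int), exists2 C2, 0 < C2 &
    forall k, mahler_value p k != 0 ->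
      1 <= C2 * lam ^+ (n * 2 ^ k) * `|mahler_value p k|.
Proof.
move=> W_alg; have [m0 [v0 [v00 a_acts0 W_acts0]]] := algebraic_pair_acts a_alg W_alg.
have [m [v [v_neq0 v_free a_acts W_acts]]] := minimal_acts v00 a_acts0 W_acts0.
have [K K0 [e lower]] := liouville v_neq0 v_free.
(* [D] is a common denominator of [a] and [W]. *)
have [da da0 [ca a_int]] := rat_int_acts a_acts.
have [dw dw0 [cw W_int]] := rat_int_acts W_acts.
pose D : R := (da * dw)%:R.
pose c0 := Num.max 1 (Num.max (dw%:R * ca) (da%:R * cw)).
have D1 : 1 <= D by rewrite ler1n muln_gt0 da0.
have c01 : 1 <= c0 by rewrite le_max lexx.
have nat_int k : int_acts v k%:R k%:R by have := int_acts_int v k; rewrite ger0_norm ?ler0n.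
have D_int : int_acts v D D by apply: nat_int.
have Da_int : int_acts v (D * a) c0.
  have -> : D * a = dw%:R * (da%:R * a) by rewrite /D natrM; ring.
  apply: (@int_acts_le _ _ _ _ (dw%:R * ca)); first by rewrite !le_max lexx orbT.
  by apply: int_actsM a_int; apply: nat_int.
have Dw_int : int_acts v (D * W) c0.
  have -> : D * W = da%:R * (dw%:R * W) by rewrite /D natrM; ring.
  apply: (@int_acts_le _ _ _ _ (da%:R * cw)); first by rewrite !le_max lexx !orbT.
  by apply: int_actsM W_int; apply: nat_int.
pose c1 := D + c0.
have Dc1 : D <= c1 by rewrite lerDl (le_trans _ c01).
have c0c1 : c0 <= c1 by rewrite lerDr (le_trans _ D1).
have c11 : 1 <= c1 by apply: le_trans Dc1.
have factor_int j : int_acts v (D ^+ (2 ^ j) * (1 - z j)) (c1 ^+ (2 ^ j)).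
  apply: (@int_acts_le _ _ _ _ (D ^+ (2 ^ j) + c0 ^+ (2 ^ j))).
    apply: addX_le; rewrite ?expn_gt0 //; exact: le_trans c01.
  have -> : D ^+ (2 ^ j) * (1 - z j) = D ^+ (2 ^ j) + (-1)%:~R * (D * a) ^+ (2 ^ j).
    by rewrite exprMn -/(z j) rmorphN rmorph1; ring.
  have N1 : int_acts v (-1)%:~R 1 by have := int_acts_int v (-1); rewrite rmorphN normrN1.
  apply: int_actsD; first exact: int_actsX.
  by rewrite -[X in int_acts _ _ X]mul1r; apply: int_actsM N1 _; apply: int_actsX.
have P_int k : int_acts v (D ^+ (2 ^ k).-1 * tm_prod a k) (c1 ^+ (2 ^ k).-1).
  elim: k => [|k IHk].
    by rewrite /tm_prod big_ord0 expn0 !expr0 mulr1; have := int_acts_int v 1; rewrite normr1.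
  have -> : (2 ^ k.+1).-1 = ((2 ^ k).-1 + 2 ^ k)%N.
    by rewrite expnS mul2n -addnn -subn1 addnC -addnBA ?expn_gt0 // subn1 addnC.
  rewrite tm_prodS !exprD mulrACA; exact: int_actsM IHk (factor_int k).
have regroup (c d1 d2 d3 d4 zi wl pr pl : R) : pl != 0 ->
    d1 * (d2 * d3 * d4) * (pr * pl) * (c * zi * (wl * pl^-1))
    = c * (d1 * (d2 * zi * (d3 * wl) * (d4 * pr))) by move=> ?; field.
have regroup2 (k s x y w : R) : k * s * (x * y) * w = k * (x * w) * (s * y) by ring.
exists ((D * c1 ^+ e) ^+ 3).
  by rewrite exprn_ege1 // mulr_ege1 // exprn_ege1.
move=> n p; pose S := 1 + \sum_il `|(p il)%:~R : R|.
have S0 : 0 < S by rewrite ltr_pwDl // sumr_ge0.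
exists (K * S ^+ e); first by rewrite mulr_gt0 // exprn_gt0.
move=> k E0; set Q := (2 ^ k)%N; set E := mahler_value p k in E0 *.
have Q0 : (0 < Q)%N by rewrite expn_gt0.
have Pk0 := tm_prod_gt0 a01 k.
have Y_int : int_acts v (D ^+ (3 * (n * Q)) * (tm_prod a k ^+ n * E))
                        (S * c1 ^+ (3 * (n * Q))).
  apply: (@int_acts_le _ _ _ _ (\sum_il `|(p il)%:~R : R| * c1 ^+ (3 * (n * Q)))).
    by rewrite -mulr_suml /S mulrDl mul1r lerDr exprn_ge0 // (le_trans _ c11).
  rewrite mulrA mulr_sumr; apply: int_acts_sum => -[i l] _ /=.
  have ln : (l <= n)%N by rewrite -ltnS.
  have i_n : (i <= n)%N by rewrite -ltnS.
  pose q := (Q * i + l + Q.-1 * (n - l))%N.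
  have qle : (q <= 3 * (n * Q))%N by apply: exponent_le.
  (* The factor [tm_prod a k ^+ n] absorbs the denominator of [f k ^+ l]. *)
  have -> : D ^+ (3 * (n * Q)) * tm_prod a k ^+ n * ((p (i, l))%:~R * z k ^+ i * f k ^+ l) =
     (p (i, l))%:~R * (D ^+ (3 * (n * Q) - q) * ((D * a) ^+ (Q * i) * (D * W) ^+ l
        * (D ^+ Q.-1 * tm_prod a k) ^+ (n - l))).
    have -> : D ^+ (3 * (n * Q)) =
       D ^+ (3 * (n * Q) - q) * (D ^+ (Q * i) * D ^+ l * (D ^+ Q.-1) ^+ (n - l)).
      by rewrite -exprM -!exprD -[in LHS](subnK qle).
    have -> : tm_prod a k ^+ n = tm_prod a k ^+ (n - l) * tm_prod a k ^+ l.
      by rewrite -exprD subnK.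
    rewrite !exprMn exprVn [a ^+ (Q * i)]exprM -/(z k).
    apply: regroup; rewrite expf_neq0 // gt_eqF //.
  have -> : c1 ^+ (3 * (n * Q)) = c1 ^+ (3 * (n * Q) - q)
       * (c1 ^+ (Q * i) * c1 ^+ l * (c1 ^+ Q.-1) ^+ (n - l)).
    by rewrite -exprM -!exprD -[in LHS](subnK qle).
  apply: int_actsM (int_acts_int _ _) _.
  have Da1 : int_acts v (D * a) c1 by apply: int_acts_le Da_int.
  have Dw1 : int_acts v (D * W) c1 by apply: int_acts_le Dw_int.
  have D1' : int_acts v D c1 by apply: int_acts_le D_int.
  apply: int_actsM (int_actsX _ D1') _; apply: int_actsM (int_actsX _ (P_int k)).
  exact: int_actsM (int_actsX _ Da1) (int_actsX _ Dw1).
have Y0 : D ^+ (3 * (n * Q)) * (tm_prod a k ^+ n * E) != 0.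
  by rewrite !mulf_neq0 // expf_neq0 // gt_eqF // (lt_le_trans _ D1).
apply: (le_trans (lower _ _ Y0 Y_int)).
have D0 : 0 <= D by apply: le_trans D1.
have c10 : 0 <= c1 by apply: le_trans c11.
rewrite !normrM !normrX (ger0_norm D0) (gtr0_norm Pk0).
have -> : K * S ^+ e * (D * c1 ^+ e) ^+ 3 ^+ (n * Q) * `|E| =
   K * (D ^+ (3 * (n * Q)) * (1 * `|E|)) * (S * c1 ^+ (3 * (n * Q))) ^+ e.
  rewrite -exprM !exprMn mul1r -!exprM [(e * _)%N]mulnC.
  exact: regroup2.
rewrite ler_wpM2r ?exprn_ge0 ?mulr_ge0 ?exprn_ge0 // ?(ltW S0) //.
rewrite ler_wpM2l ?(ltW K0) // ler_wpM2l ?exprn_ge0 // ler_wpM2r //.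
by rewrite exprn_ile1 ?(ltW Pk0) // tm_prod_le1.
Qed.

(** The upper bound [z k ^+ (n * n).+1] is of size [a ^+ (n ^ 2 * 2 ^ k)]; it beats
    the lower bound [lam ^- (n * 2 ^ k)] once [lam * a ^+ n <= 1]. *)
Theorem tm_prod_limit_transcendental : ~ algebraicOver (ratr : rat -> R) W.
Proof.
move=> W_alg; have /andP[a0 a1] := a01.
have [lam lam1 lower] := mahler_value_lower W_alg.
have [n0 small] := expr_small lam a01; pose n := n0.+1.
have lam_small : lam * a ^+ n <= 1 by apply/ltW/small/leqnSn.
have [p p0 [C0 C00 aux]] := @auxiliary_poly R n (n * n).+1 isT.
have [C1 C10 upper] := mahler_value_le C00 aux.
have [C2 C20 {}lower] := lower n p.
have [k0 {}small] := expr_small (C2 * C1) a01.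
have [k k0k E0] := mahler_value_neq0 k0 p0.
have Q_k0 : (k0 <= 2 ^ k)%N by apply: leq_trans k0k _; apply/ltnW/ltn_expl.
have := small _ Q_k0; apply/negP; rewrite -leNgt.
apply: (le_trans (lower k E0)); set Q := (2 ^ k)%N.
have lam0 : 0 <= lam by apply: le_trans lam1.
apply: (@le_trans _ _ (C2 * lam ^+ (n * Q) * (C1 * z k ^+ (n * n).+1))).
  by rewrite ler_wpM2l ?upper // mulr_ge0 ?exprn_ge0 // ltW.
have -> : C2 * lam ^+ (n * Q) * (C1 * z k ^+ (n * n).+1) =
    C2 * C1 * a ^+ Q * (lam * a ^+ n) ^+ (n * Q).
  rewrite exprMn -exprM /z -exprM -/Q.
  have -> : (Q * (n * n).+1 = Q + n * (n * Q))%N by rewrite mulnS mulnC mulnA.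
  by rewrite exprD; ring.
rewrite ler_piMr ?exprn_ile1 //; last by rewrite mulr_ge0 // exprn_ge0 // ltW.
by rewrite mulr_ge0 ?exprn_ge0 ?mulr_ge0 // ltW.
Qed.

End MahlerMethod.

(** * Quasi-greedy expansions as sequences with remainders in ]0, 1] *)

Section Remainders.
Variable R : realType.
Implicit Types (a : nat -> nat) (b c : R).

(** The scaled remainder [b ^+ n * (1 - V)], where [V] is the value of the first
    [n] digits; see [remainder_block_value]. *)
Fixpoint remainder a b n : R := if n is m.+1 then b * remainder a b m - (a m)%:R else 1.

Definition is_expansion (N : nat) b a :=
  forall n, (a n < N)%N /\ 0 < remainder a b n <= 1.

Lemma remainder_ext a a' b n : (forall i, (i < n)%N -> a i = a' i) ->
  remainder a b n = remainder a' b n.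
Proof.
elim: n => //= n IHn aa'; rewrite aa' // IHn // => i ltin.
by apply: aa'; apply: ltnW.
Qed.

Lemma block_value_rcons b s d :
  block_value b (rcons s d) = block_value b s + d%:R / b ^+ (size s).+1.
Proof.
rewrite /block_value size_rcons big_ord_recr /= nth_rcons ltnn eqxx.
by congr (_ + _); apply: eq_bigr => i _; rewrite nth_rcons ltn_ord.
Qed.

Lemma remainder_block_value a b n : 0 < b ->
  remainder a b n = b ^+ n * (1 - block_value b (mkseq a n)).
Proof.
move=> b0; have b_n0 : b != 0 by rewrite gt_eqF.
elim: n => [|n IHn] /=; first by rewrite /block_value /= big_ord0 subr0 expr0 mulr1.
rewrite IHn mkseqS block_value_rcons size_mkseq exprS.
by field; rewrite expf_neq0 // b_n0.
Qed.

Lemma quasi_greedy_prefixE N b n :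
  quasi_greedy_prefix N b n = mkseq (quasi_greedy N b) n.
Proof.
elim: n => // n IHn; rewrite mkseqS -IHn /quasi_greedy.
have sz : size (quasi_greedy_prefix N b n) = n by rewrite IHn size_mkseq.
by rewrite /= nth_rcons sz ltnn eqxx.
Qed.

Lemma quasi_greedyE N b n (a := quasi_greedy N b) : 0 < b ->
  a n = (\max_(d < N | (d%:R < b * remainder a b n)%R) d)%N.
Proof.
move=> b0; rewrite {1}/a /quasi_greedy /=.
rewrite nth_rcons quasi_greedy_prefixE size_mkseq ltnn eqxx.
apply: eq_bigl => d; rewrite block_value_rcons size_mkseq remainder_block_value //.
by rewrite -ltrBrDl ltr_pdivrMr ?exprn_gt0 // [in RHS]mulrA -exprS [in RHS]mulrC.
Qed.

Lemma quasi_greedy_expansion N b : 1 < b <= N%:R -> is_expansion N b (quasi_greedy N b).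
Proof.
move=> /andP[b1 bN]; have b0 : 0 < b by apply: lt_trans b1.
have N1 : (1 < N)%N by rewrite -(ltr1n R) (lt_le_trans b1).
have N0 : (0 < N)%N by apply: ltnW.
set a := quasi_greedy N b.
have step n : 0 < remainder a b n <= 1 -> (a n < N)%N /\ 0 < remainder a b n.+1 <= 1.
  move=> /andP[r0 r1].
  have := quasi_greedyE N n b0; rewrite -/a => anE.
  pose P := [pred d : 'I_N | (d%:R < b * remainder a b n)%R].
  have [|d Pd maxd] := @eq_bigmax_cond _ P (fun d => d : nat).
    by apply/card_gt0P; exists (Ordinal N0); rewrite inE mulr_gt0.
  have {maxd} and : a n = d by rewrite anE -maxd.
  rewrite inE /= in Pd; rewrite /= and subr_gt0 Pd /=; split => //; rewrite lerBlDr.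
  have [lt_dN|] := ltnP d.+1 N.
    rewrite addrC natr1 leNgt; apply/negP=> lt_d1.
    have : (Ordinal lt_dN <= a n)%N by rewrite anE (@leq_bigmax_cond _ P (fun d => d : nat)).
    by rewrite and /= ltnn.
  move=> Nd; have -> : 1 + d%:R = N%:R :> R.
    by rewrite addrC natr1; congr (_%:R); apply/eqP; rewrite eqn_leq Nd ltn_ord.
  by apply: le_trans bN; rewrite ger_pMr.
move=> n; suff rn : 0 < remainder a b n <= 1 by split=> //; case: (step n rn).
by elim: n => [|n /step[]//]; rewrite /= ltr01 lexx.
Qed.

Lemma expansion_unique N b a a' : is_expansion N b a -> is_expansion N b a' -> a =1 a'.
Proof.
move=> ea ea' n; have [m] := ubnP n; elim: m n => // m IHm n ltnm.
have re : remainder a b n = remainder a' b n.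
  by apply: remainder_ext => i lti; apply: IHm; apply: leq_trans lti _.
have [_ /andP[r0 r1]] := ea n.+1; have [_ /andP[r0' r1']] := ea' n.+1.
move: r0 r1 r0' r1'; rewrite /= re; set x := b * _ => r0 r1 r0' r1'.
have : `|(a n)%:R - (a' n)%:R : R| < 1 by rewrite ltr_norml; lra.
have [le_aa'|lt_aa'] := leqP (a n) (a' n).
  rewrite distrC -natrB // normr_nat ltrn1 => /eqP; lia.
rewrite -natrB 1?ltnW // normr_nat ltrn1 => /eqP; lia.
Qed.

(** Maximality of a digit says that the next remainder is at most 1; for the top
    digit [N - 1] this follows from [b <= N] instead. *)
Lemma quasi_greedyP N b a : 1 < b <= N%:R ->
  (quasi_greedy N b =1 a) <-> is_expansion N b a.
Proof.
move=> bN; have qe := quasi_greedy_expansion bN; split; last exact: expansion_unique.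
by move=> qa n; have := qe n; rewrite qa (@remainder_ext _ a).
Qed.

(** Lexicographic comparison is expressed through the first difference:
    [shiftle a] says that no shift of [a] exceeds [a], and [reflge N a] that no
    shift is smaller than the reflection of [a]. *)
Definition shiftle a := forall n m,
  (forall i, (i < m)%N -> a (n + i)%N = a i) -> (a (n + m)%N <= a m)%N.

Definition reflge N a := forall n m,
  (forall i, (i < m)%N -> a (n + i)%N = N.-1 - a i)%N -> (N.-1 - a m <= a (n + m))%N.

(** As long as the shift agrees with [a] its remainder does not exceed that of
    [a], because it starts from a remainder at most 1; the maximal digit cannot
    then be larger. *)
Lemma expansion_shiftle N b a : 0 < b -> is_expansion N b a -> shiftle a.
Proof.
move=> b0 ea n m am.
have : remainder a b (n + m) <= remainder a b m.
  elim: m am => [|m IHm] am; first by rewrite addn0; have [_ /andP[]] := ea n.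
  rewrite addnS /= am // lerB // ler_pM2l // IHm // => i lti.
  by apply: am; apply: ltnW.
have [_ /andP[r0 _]] := ea (n + m).+1; have [_ /andP[_ r1]] := ea m.+1.
move: r0 r1 => /= r0 r1 le_r; rewrite -ltnS -(ltr_nat R) -natr1.
have := ler_pM2l b0 (remainder a b (n + m)) (remainder a b m); rewrite le_r => /idP; lra.
Qed.

Lemma remainderD a b n m :
  remainder a b (n + m) =
  remainder (fun i => a (n + i)%N) b m + b ^+ m * (remainder a b n - 1).
Proof.
elim: m => [|m IHm]; first by rewrite addn0 /= expr0; ring.
by rewrite addnS /= IHm exprS; ring.
Qed.

(** At its first difference with [a] a shift has a smaller digit, so the
    remainder there is at least 1 more than that of [a]; from then on the digits
    form another shift, started from a remainder at least 1. *)
Lemma remainder_shift_ge0 a b : 0 <= b -> (forall n, 0 <= remainder a b n) -> shiftle a ->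
  forall m n, 0 <= remainder (fun i => a (n + i)%N) b m.
Proof.
move=> b0 r0 sa m; have [k] := ubnP m; elim: k m => // k IHk m ltmk n.
case: (boolP [exists i : 'I_m, a (n + i)%N != a i]) => [/existsP ne|]; last first.
  move=> /existsPn eqa; rewrite (@remainder_ext _ a) // => i ltim.
  by have := eqa (Ordinal ltim); rewrite negbK => /eqP.
have {}ne : exists i, (i < m)%N && (a (n + i)%N != a i).
  by case: ne => i ne; exists i; rewrite ltn_ord.
case: (ex_minnP ne) => j /andP[ltjm nej] minj.
have eqa i : (i < j)%N -> a (n + i)%N = a i.
  move=> ltij; apply/eqP; apply: contraLR ltij => nei; rewrite -leqNgt.
  by have [/(leq_trans ltjm)/ltnW|ltim] := leqP m i; last by apply: minj; rewrite ltim.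
have ltaj : (a (n + j)%N < a j)%N by rewrite ltn_neqAle nej sa.
have rj : 1 <= remainder (fun i => a (n + i)%N) b j.+1.
  rewrite /= (@remainder_ext _ a) //; have := r0 j.+1 => /=.
  by move: ltaj; rewrite -(ler_nat R) -natr1; lra.
rewrite -(subnK ltjm) addnC remainderD addr_ge0 ?mulr_ge0 ?exprn_ge0 ?subr_ge0 //.
rewrite (@remainder_ext _ (fun i => a (n + j.+1 + i)%N)); last by move=> i _; rewrite addnA.
by apply: IHk; lia.
Qed.

(** Hence a remainder larger than 1 makes the remainders grow geometrically. *)
Lemma remainder_growth a b n m :
  0 <= b -> (forall k, 0 <= remainder a b k) -> shiftle a ->
  b ^+ m * (remainder a b n - 1) <= remainder a b (n + m).
Proof. by move=> b0 r0 sa; rewrite remainderD lerDr remainder_shift_ge0. Qed.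

(** Above [N / (b - 1)] the recursion can only increase the remainder. *)
Lemma remainder_large N a b n : (forall i, (a i < N)%N) -> 1 < b ->
  N%:R <= (b - 1) * remainder a b n ->
  forall m, (n <= m)%N -> N%:R <= (b - 1) * remainder a b m.
Proof.
move=> aN b1 rn m /subnK<-; elim: (m - n)%N => // k IHk.
have := aN (k + n)%N; rewrite -(ltr_nat R) => ak.
have b0 : 0 < b - 1 by rewrite subr_gt0.
rewrite addSn /=; apply: (le_trans IHk); rewrite ler_pM2l //.
move: IHk; nra.
Qed.

Lemma remainder_lipschitz N a b0 n : (forall i, (a i < N)%N) ->
  exists2 C : R, 0 <= C &
    forall b c, 0 <= b <= b0 -> 0 <= c <= b0 ->
      `|remainder a b n - remainder a c n| <= C * `|b - c|.
Proof.
move=> aN; elim: n => [|n [C C0 IHn]].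
  by exists 0 => // b c _ _; rewrite /= subrr normr0 mul0r.
have bound : exists2 M, 0 <= M & forall c, 0 <= c <= b0 -> `|remainder a c n| <= M.
  exists (`|remainder a 0 n| + C * `|b0|); first by rewrite addr_ge0 // mulr_ge0.
  move=> c /andP[c0 cb]; have b00 : 0 <= b0 by apply: le_trans cb.
  rewrite -[X in `|X| <= _](subrKC (remainder a 0 n)).
  apply: (le_trans (ler_normD _ _)); rewrite lerD2l.
  have := IHn c 0; rewrite c0 cb b00 lexx subr0 => /(_ isT isT).
  by move=> h; apply: (le_trans h); rewrite ler_wpM2l // !ger0_norm.
have [M M0 Mb] := bound; exists (`|b0| * C + M); first by rewrite addr_ge0 ?mulr_ge0.
move=> b c bb cb; rewrite /=.
have -> : b * remainder a b n - (a n)%:R - (c * remainder a c n - (a n)%:R) =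
  b * (remainder a b n - remainder a c n) + (b - c) * remainder a c n by ring.
apply: (le_trans (ler_normD _ _)); rewrite !normrM mulrDl lerD //.
  rewrite -mulrA ler_pM // ?IHn //.
  by case/andP: bb => b_ge0 b_le; rewrite !ger0_norm // (le_trans b_ge0).
by rewrite mulrC ler_wpM2r // Mb.
Qed.

Lemma remainder_mono a b c n : 0 < b <= c -> (forall i, (i < n)%N -> 0 < remainder a b i) ->
  remainder a b n <= remainder a c n.
Proof.
move=> /andP[b0 bc]; elim: n => //= n IHn pos.
have rn := pos n (ltnSn n).
have {}IHn : remainder a b n <= remainder a c n.
  by apply: IHn => i lti; apply: pos; apply: ltnW.
by rewrite lerD2r ler_pM // ltW.
Qed.

(** The base is the infimum of the bases above [G] for which all remainders are
    positive. A remainder larger than 1 at the infimum would blow up by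
    [remainder_growth], and then all remainders would still be positive slightly
    below the infimum. The last hypothesis settles the case where the infimum
    is [G]. *)
Lemma exists_expansion N a G :
    1 < G <= N%:R -> (forall i, (a i < N)%N) -> shiftle a ->
    (forall n, exists2 m, (n <= m)%N & (0 < a m)%N) ->
    ((forall n, 0 < remainder a G n) -> forall n, remainder a G n <= 1) ->
  exists2 b, G <= b <= N%:R & is_expansion N b a.
Proof.
move=> /andP[G1 GN] aN sa a_inf aG.
pose T := [set b | G <= b /\ forall n, 0 < remainder a b n]%classic.
have TN : T N%:R.
  split=> // n; suff : 1 <= remainder a N%:R n by apply: lt_le_trans.
  elim: n => //= n IHn; have := aN n; rewrite -(ler_nat R) -natr1.
  have : (0 : R) <= N%:R by []. nra.
have Tlb : lbound T G by move=> b [].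
have T0 : (T !=set0)%classic by exists N%:R.
have hT : has_inf T by split=> //; exists G.
pose be := inf T.
have Gbe : G <= be by apply: lb_le_inf.
have beN : be <= N%:R by apply: ge_inf => //; exists G.
have be1 : 1 < be by apply: lt_le_trans Gbe.
have be0 : 0 < be by apply: lt_trans be1.
have inf_le b : T b -> be <= b by apply: ge_inf; exists G.
have r_ge0 n : 0 <= remainder a be n.
  rewrite leNgt; apply/negP=> rn; pose s := - remainder a be n.
  have s0 : 0 < s by rewrite oppr_gt0.
  have [C C0 lip] := @remainder_lipschitz N a (N%:R + s) n aN.
  have C1 : 0 < C + 1 by rewrite ltr_wpDl.
  have [|b Tb b_lt] := @inf_lt _ T (be + s / (C + 1)) T0; first by rewrite ltrDl divr_gt0.
  have be_b := inf_le b Tb; have [_ /(_ n) bpos] := Tb.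
  have bs : b - be < s / (C + 1) by rewrite ltrBlDl.
  have s_le : s / (C + 1) <= s by rewrite ler_pdivrMr // ler_peMr // ?lerDr // ltW.
  have : `|remainder a b n - remainder a be n| <= C * `|b - be|.
    by apply: lip; apply/andP; split; lra.
  rewrite !ger0_norm ?subr_ge0 //; last by apply: (le_trans (ltW rn)); apply: ltW.
  have : C * (b - be) <= C * (s / (C + 1)) by rewrite ler_wpM2l // ltW.
  have : C * (s / (C + 1)) <= s.
    by rewrite mulrA ler_pdivrMr // mulrC ler_pM2l // lerDl.
  by rewrite /s; lra.
have r_gt0 n : 0 < remainder a be n.
  rewrite lt_def r_ge0 andbT; apply/eqP=> rn0.
  have zero m : remainder a be (n + m) = 0.
    elim: m => [|m IHm]; first by rewrite addn0.
    have := r_ge0 (n + m).+1; rewrite addnS /= IHm mulr0 sub0r oppr_ge0 lern0.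
    by move=> /eqP->; rewrite oppr0.
  have [m nm am] := a_inf n.
  have := r_ge0 m.+1; rewrite /= -(subnKC nm) zero mulr0 sub0r oppr_ge0 lern0 subnKC //.
  by rewrite eqn0Ngt am.
exists be; first by rewrite Gbe.
move=> n; split=> //; rewrite r_gt0 /=.
move: Gbe; rewrite le_eqVlt => /predU1P[Geq|Gbe].
  by rewrite -Geq; apply: aG => k; rewrite Geq.
rewrite leNgt; apply/negP=> rn1.
pose c := (G + be) / 2.
have cbe : c < be by rewrite /c; lra.
have Gc : G < c by rewrite /c; lra.
have c1 : 1 < c by apply: lt_trans Gc.
(* By [remainder_large] it is enough to keep the first [m] remainders positive. *)
have [m m_large] : exists m, N%:R / (c - 1) + 1 <= remainder a be m.
  have beV : 0 < be^-1 < 1 by rewrite invr_gt0 be0 invf_lt1.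
  have [k /(_ k (leqnn k)) small] :=
    expr_small ((N%:R / (c - 1) + 1) / (remainder a be n - 1)) beV.
  exists (n + k)%N; apply: le_trans (remainder_growth _ _ (ltW be0) r_ge0 sa).
  move: small; rewrite exprVn ltr_pdivrMr ?exprn_gt0 // mul1r ltr_pdivrMr ?subr_gt0 //.
  exact: ltW.
have lipm : exists2 C, 0 < C & forall k, (k <= m)%N ->
    forall b, 0 <= b <= be -> `|remainder a b k - remainder a be k| <= C * `|b - be|.
  have /fin_all_exists[C hC] : forall k : 'I_m.+1, exists C, 0 <= C /\
      forall b, 0 <= b <= be -> `|remainder a b k - remainder a be k| <= C * `|b - be|.
    move=> k; have [C C0 lip] := @remainder_lipschitz N a be k aN.
    by exists C; split=> // b bb; apply: lip => //; rewrite lexx ltW.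
  exists (1 + \sum_k C k); first by rewrite ltr_pwDl // sumr_ge0 // => k _; case: (hC k).
  move=> k km b bb; have [_ /(_ b bb) h] := hC (Ordinal (km : (k < m.+1)%N)).
  apply: (le_trans h); rewrite ler_wpM2r //.
  rewrite (bigD1 (Ordinal (km : (k < m.+1)%N))) //= addrCA lerDl addr_ge0 // sumr_ge0 //.
  by move=> i _; case: (hC i).
have [C C0 lip] := lipm.
have [d d0 dP] : exists2 d, 0 < d & forall k, (k <= m)%N -> d <= remainder a be k.
  exists (\big[Num.min/1]_(k < m.+1) remainder a be k).
    by elim/big_ind: _ => // x y x0 y0; rewrite lt_min x0.
  move=> k km; rewrite (bigD1 (Ordinal (km : (k < m.+1)%N))) //=.
  by rewrite ge_min lexx.
pose b := Num.max c (be - Num.min 1 (d / 2) / C).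
have eps0 : 0 < Num.min 1 (d / 2) / C by rewrite divr_gt0 // lt_min ltr01 divr_gt0.
have b_be : b < be by rewrite gt_max cbe gtrBl.
have cb : c <= b by rewrite le_max lexx.
have close k : (k <= m)%N -> `|remainder a b k - remainder a be k| <= Num.min 1 (d / 2).
  move=> km; have bb : 0 <= b <= be by apply/andP; split; lra.
  apply: (le_trans (lip k km b bb)); rewrite mulrC -ler_pdivlMr //.
  have : be - Num.min 1 (d / 2) / C <= b by rewrite le_max lexx orbT.
  by rewrite distrC ger0_norm; lra.
have Tb : T b.
  split; first by lra.
  move=> k; have [km|mk] := leqP k m.
    have := close k km; have := dP k km; rewrite le_min ler_norml => dk /andP[_].
    by rewrite ler_norml => /andP[]; lra.
  have : N%:R <= (b - 1) * remainder a b k.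
    apply: (@remainder_large N a b m) (ltnW mk) => //; first by lra.
    have : N%:R / (c - 1) <= remainder a b m.
      by have := close m (leqnn m); rewrite le_min ler_norml => /andP[/andP[]]; lra.
    rewrite ler_pdivrMr ?subr_gt0 //; have : (0 : R) <= N%:R by []. nra.
  have N0 : (0 : R) < N%:R by apply: lt_le_trans GN; lra.
  by move/(lt_le_trans N0); rewrite pmulr_rgt0 //; lra.
by have := inf_le b Tb; rewrite leNgt b_be.
Qed.

End Remainders.

(** * The sequence theta *)

Section Theta.
Variables (N p : nat) (t : seq nat).
Hypotheses (p0 : (0 < p)%N) (size_t : size t = p).
Local Notation T := (nth 0%N t).
Local Notation th := (theta N (block_plus t)).

Lemma size_block_plus s : (0 < size s)%N -> size (block_plus s) = size s.
Proof. by case: s => // x s _; rewrite /block_plus size_set_nth /=; apply/maxn_idPr. Qed.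

Lemma nth_block_plus s i : (i < size s)%N ->
  nth 0%N (block_plus s) i = (nth 0 s i + (i.+1 == size s))%N.
Proof.
case: s => // x s lti; rewrite /block_plus nth_set_nth /= eqSS.
by case: eqVneq => [->|]; rewrite ?addn0 // addn1 nth_last.
Qed.

Lemma size_reflection M s : size (reflection M s) = size s.
Proof. exact: size_map. Qed.

Lemma nth_reflection M s i : (i < size s)%N ->
  nth 0%N (reflection M s) i = (M.-1 - nth 0 s i)%N.
Proof. by move=> lti; rewrite (nth_map 0%N). Qed.

Lemma size_theta_block m : size (theta_block N (block_plus t) m) = (2 ^ m * p)%N.
Proof.
elim: m => [|m IHm] /=; first by rewrite mul1n size_block_plus size_t.
rewrite size_cat size_block_plus size_reflection IHm ?muln_gt0 ?expn_gt0 //.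
by rewrite expnS; lia.
Qed.

Lemma theta_block_prefix m k i : (i < 2 ^ m * p)%N ->
  nth 0%N (theta_block N (block_plus t) (k + m)) i =
  nth 0%N (theta_block N (block_plus t) m) i.
Proof.
move=> lti; elim: k => // k IHk; rewrite addSn /= nth_cat size_theta_block IHk.
by rewrite (leq_trans lti) // leq_pmul2r // leq_exp2l // leq_addl.
Qed.

Lemma theta_blockE m i : (i < 2 ^ m * p)%N ->
  th i = nth 0%N (theta_block N (block_plus t) m) i.
Proof.
move=> lti; rewrite /theta.
have lti' : (i < 2 ^ i * p)%N.
  by apply: (leq_trans (@ltn_expl 2 i isT)); rewrite leq_pmulr.
have [mi|im] := leqP m i.
  by have := @theta_block_prefix m (i - m) i lti; rewrite subnK.
by have := @theta_block_prefix i (m - i) i lti'; rewrite subnK // ltnW.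
Qed.

(** [theta_lo] and [theta_hi] determine theta; the booleans are the increments of
    the last digits of the blocks. *)
Lemma theta_lo i : (i < p)%N -> th i = (T i + (i.+1 == p))%N.
Proof.
by move=> lti; rewrite (@theta_blockE 0) ?mul1n //= nth_block_plus size_t.
Qed.

Lemma theta_hi m i : (i < 2 ^ m * p)%N ->
  th (2 ^ m * p + i)%N = (N.-1 - th i + (i.+1 == 2 ^ m * p))%N.
Proof.
move=> lti; rewrite (@theta_blockE m.+1); last by rewrite expnS; lia.
rewrite /= nth_cat size_theta_block ltnNge leq_addr /= addKn.
rewrite nth_block_plus size_reflection size_theta_block //.
by rewrite nth_reflection ?size_theta_block // -theta_blockE.
Qed.

Lemma pow2_cover i : exists m, (i < 2 ^ m * p)%N.
Proof. by exists i; apply: (leq_trans (@ltn_expl 2 i isT)); rewrite leq_pmulr. Qed.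

Hypotheses (t_digits : forall i, (i < p)%N -> (T i < N)%N) (t_last : (T p.-1 < N.-1)%N).

(** The last digit of each block is positive, so that the increment of its
    reflection stays below [N]. *)
Lemma theta_bounds m : (0 < th (2 ^ m * p).-1)%N /\
  forall i, (i < 2 ^ m * p)%N -> (th i <= N.-1)%N.
Proof.
elim: m => [|m [IHl IHm]].
  rewrite mul1n; split; first by rewrite theta_lo ?prednK // eqxx addn1.
  move=> i ltip; rewrite theta_lo //; have := t_digits ltip.
  case: eqP; last by lia.
  move=> ip; have ip1 : i = p.-1 by lia.
  by rewrite ip1; have := t_last; lia.
have q0 : (0 < 2 ^ m * p)%N by rewrite muln_gt0 expn_gt0.
have -> : (2 ^ m.+1 * p = 2 ^ m * p + 2 ^ m * p)%N by rewrite expnS; lia.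
set q := (2 ^ m * p)%N in IHl IHm q0 *; split.
  have -> : (q + q).-1 = (q + q.-1)%N by lia.
  by rewrite /q theta_hi -/q ?prednK // eqxx addn1.
move=> i ltiq; have [/IHm//|qi] := ltnP i q.
rewrite -(subnKC qi) /q theta_hi -/q; last by lia.
case: eqP => [iq|_]; last by lia.
have -> : (i - q)%N = q.-1 by lia.
by lia.
Qed.

Lemma theta_le i : (th i <= N.-1)%N.
Proof. by have [m lti] := pow2_cover i; have [_ /(_ i lti)] := theta_bounds m. Qed.

End Theta.

(** * Order relations preserved by reflecting and doubling a block *)

Section BlockOrder.
Variables (N : nat) (th : nat -> nat).

(** For the block [w] of the first [q] digits: each proper suffix is at most the
    prefix of its length and strictly above the reflection of that prefix, and
    [w] itself is strictly above its reflection. The comparisons stay inside [w],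
    which makes the property hereditary under doubling. *)
Record block_order (q : nat) : Prop := BlockOrder {
  block_ub : forall s j, (0 < s)%N -> (s + j < q)%N ->
    (forall i, (i < j)%N -> th (s + i)%N = th i) -> (th (s + j)%N <= th j)%N;
  block_lb : forall s, (0 < s < q)%N -> exists2 j, (s + j < q)%N &
    (forall i, (i < j)%N -> th (s + i)%N = N.-1 - th i)%N /\ (N.-1 - th j < th (s + j)%N)%N;
  block_lb0 : exists2 j, (j < q)%N &
    (forall i, (i < j)%N -> th i = N.-1 - th i)%N /\ (N.-1 - th j < th j)%N }.

Hypothesis th_le : forall i, (th i <= N.-1)%N.

(** Write [w'] for the reflection of [w] with its last digit incremented, so that
    the new block is [w w']. A suffix of [w] that ties with a prefix of [w] is
    followed by a reflected prefix, which loses strictly against the suffix of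
    [w] it is compared with. A suffix of [w'] is a reflected suffix of [w], with
    upper and lower bounds exchanged; the final increment makes its lower bound
    strict. *)
Lemma block_order_double q : (0 < q)%N ->
  (forall i, (i < q)%N -> th (q + i)%N = N.-1 - th i + (i.+1 == q))%N ->
  block_order q -> block_order (q + q).
Proof.
move=> q0 hi [ub lb [j0 j0q [eq0 lt0]]].
have hi_lt i : (i.+1 < q)%N -> th (q + i)%N = (N.-1 - th i)%N.
  by move=> lti; rewrite hi ?(ltn_eqF lti) ?addn0 // ltnW.
have hi_le i : (i < q)%N -> (th (q + i)%N <= (N.-1 - th i).+1)%N.
  by move=> lti; rewrite hi //; case: eqP; lia.
split.
- move=> s j s0 sjq eqj.
  have [sq|] := ltnP s q.
    have [sjq'|qsj] := ltnP (s + j) q; first exact: ub.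
    have [|j' j'q [eq' lt']] := lb (q - s)%N; first by lia.
    have [k jE] : exists k, j = (q - s + k)%N by exists (j - (q - s))%N; lia.
    have -> : (s + j = q + k)%N by lia.
    have [kj'|] := ltnP k j'; first by rewrite hi_lt ?jE ?eq' //; lia.
    rewrite leq_eqVlt => /predU1P[j'k|j'k].
      by rewrite jE -j'k hi_lt; [exact: ltnW | lia].
    have /eqj : (q - s + j' < j)%N by lia.
    have -> : (s + (q - s + j') = q + j')%N by lia.
    rewrite hi_lt; lia.
  rewrite leq_eqVlt => /predU1P[qs|qs].
    subst s; have [jj0|] := ltnP j j0; first by rewrite hi_lt -?eq0 //; lia.
    rewrite leq_eqVlt => /predU1P[<-|j0j].
      by apply: leq_trans (hi_le _ j0q) _.
    by have := eqj _ j0j; rewrite hi_lt; lia.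
  have [s' sE] : exists s', s = (q + s')%N by exists (s - q)%N; lia.
  subst s; have [|j' j'q [eq' lt']] := lb s'; first by lia.
  have [jj'|] := ltnP j j'.
    by rewrite -addnA hi_lt; [rewrite eq' //; have := th_le j; lia|lia].
  have le1 := th_le j'; have le2 := th_le (s' + j')%N.
  rewrite leq_eqVlt => /predU1P[<-|j'j].
    by rewrite -addnA; apply: leq_trans (hi_le _ j'q) _; lia.
  by have := eqj _ j'j; rewrite -addnA hi_lt; lia.
- move=> s /andP[s0 sq2]; have [sq|] := ltnP s q.
    have [|j jq [eqj ltj]] := lb s; first by lia.
    by exists j => //; lia.
  rewrite leq_eqVlt => /predU1P[qs|qs].
    exists q.-1; [lia|split]; first by move=> i lti; rewrite -qs hi_lt //; lia.
    rewrite -qs hi ?prednK ?eqxx //; lia.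
  have [s' sE] : exists s', s = (q + s')%N by exists (s - q)%N; lia.
  subst s.
  (* The first place where the suffix differs or receives the increment. *)
  have ex : exists j, (s' + j < q)%N && ((th (s' + j)%N != th j) || ((s' + j).+1 == q)).
    exists (q.-1 - s')%N; apply/andP; split; first by lia.
    by apply/orP; right; apply/eqP; lia.
  case: (ex_minnP ex) => j /andP[jq jP] minj.
  have eqj i : (i < j)%N -> th (s' + i)%N = th i /\ ((s' + i).+1 < q)%N.
    move=> ltij.
    have : ~~ ((s' + i < q)%N && ((th (s' + i)%N != th i) || ((s' + i).+1 == q))).
      by apply: contraL ltij => /minj; rewrite -leqNgt.
    have -> : (s' + i < q)%N by lia.
    rewrite /= negb_or negbK => /andP[/eqP-> ne]; split=> //.
    by rewrite ltn_neqAle ne /=; lia.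
  exists j; first by lia.
  split=> [i lti|].
    by have [e1 e2] := eqj i lti; rewrite -addnA hi_lt // e1.
  have le_j : (th (s' + j)%N <= th j)%N by apply: ub => [||i /eqj[]] //; lia.
  have := th_le j; rewrite -addnA hi //; case/orP: jP => [ne|->]; last by lia.
  have : (th (s' + j)%N < th j)%N by rewrite ltn_neqAle ne.
  lia.
- by exists j0; [lia|].
Qed.

Lemma block_order_shiftle (cover : forall i, exists2 q, (i < q)%N & block_order q) :
  shiftle th.
Proof.
move=> [|n] m eqm; first by rewrite add0n.
by have [q lt_q []] := cover (n.+1 + m)%N; move=> /(_ n.+1 m isT lt_q eqm).
Qed.

Lemma block_order_reflge (cover : forall i, exists2 q, (i < q)%N & block_order q) :
  reflge N th.
Proof.
move=> n m eqm; have [q lt_q [_ lb lb0]] := cover (n + m)%N.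
have [j [eqj ltj]] : exists j,
    (forall i, (i < j)%N -> th (n + i)%N = N.-1 - th i)%N
    /\ (N.-1 - th j < th (n + j)%N)%N.
  case: n eqm lt_q => [|n] eqm lt_q; first by have [j _ ?] := lb0; exists j.
  by have [|j _ ?] := lb n.+1; [lia|exists j].
have [mj|] := ltnP m j; first by rewrite eqj.
rewrite leq_eqVlt => /predU1P[<-|jm]; first exact: ltnW.
by rewrite eqm // ltnn in ltj.
Qed.

End BlockOrder.

(** * Admissible blocks *)

Lemma lexleP s t : size s = size t ->
  lexle s t <-> (forall m, (m < size s)%N ->
     (forall i, (i < m)%N -> nth 0%N s i = nth 0%N t i) ->
     (nth 0%N s m <= nth 0%N t m)%N).
Proof.
elim: s t => [|x s IHs] [|y t] //= [sz].
rewrite /lexle Order.SeqLexiOrder.lexi_cons !leEnat; split.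
  case/andP=> xy /implyP st [|m] //= ltm eqm.
  have /= xy0 := eqm 0%N isT; rewrite xy0 leqnn in st.
  by apply: (IHs t sz).1 => // [|i lti]; [apply: st|apply: (eqm i.+1)].
move=> st; rewrite (st 0%N) //=; apply/implyP=> yx.
have xy : x = y by apply/eqP; rewrite eqn_leq yx (st 0%N).
by apply/(IHs t sz).2 => m ltm eqm; apply: (st m.+1) => // -[|i] //=; apply: eqm.
Qed.

Section Admissible.
Variables (N p : nat) (t : seq nat).
Hypotheses (p0 : (0 < p)%N) (size_t : size t = p).
Local Notation T := (nth 0%N t).
Local Notation th := (theta N (block_plus t)).
Let thlo := theta_lo N p0 size_t.

Lemma nth_rotation s i : (s < p)%N -> (i < p)%N ->
  nth 0%N (drop s t ++ take s t) i = periodic t (s + i)%N.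
Proof.
move=> sp ip; rewrite nth_cat size_drop size_t /periodic size_t nth_drop.
have [si|si] := ltnP i (p - s); first by rewrite modn_small //; lia.
rewrite nth_take; last by lia.
have -> : (s + i = p + (i - (p - s)))%N by lia.
by rewrite modnDl modn_small //; lia.
Qed.

(** The blocks of the second admissibility condition are windows of theta: the
    second half of [theta_block] opens with the reflected digits of [t]. *)
Lemma theta_window s i : (s < p)%N -> (i < p)%N ->
  nth 0%N (drop s (block_plus t) ++ reflection N (take s t)) i = th (s + i)%N.
Proof.
move=> sp ip; rewrite nth_cat size_drop size_block_plus size_t //.
have [si|si] := ltnP i (p - s).
  have sip : (s + i < p)%N by lia.
  by rewrite nth_drop nth_block_plus size_t // thlo.
have -> : (s + i = 2 ^ 0 * p + (i - (p - s)))%N by lia.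
rewrite theta_hi ?mul1n //; last by lia.
rewrite thlo //; last by lia.
rewrite nth_reflection ?size_take_min ?size_t; last by lia.
rewrite nth_take; last by lia.
by case: eqP; lia.
Qed.

(** The two admissibility conditions, read off infinite sequences at their first
    difference. *)
Definition admissible_lower := forall s j, (s < p)%N -> (j < p)%N ->
  (forall i, (i < j)%N -> N.-1 - T i = periodic t (s + i))%N ->
  (N.-1 - T j <= periodic t (s + j))%N.

Definition admissible_upper := forall s j, (s < p)%N -> (j < p)%N ->
  (forall i, (i < j)%N -> th (s + i) = th i)%N -> (th (s + j) <= th j)%N.

Lemma periodicD n i : periodic t (n + i)%N = periodic t (n %% p + i)%N.
Proof. by rewrite /periodic size_t modnDml. Qed.

Lemma periodic_small i : (i < p)%N -> periodic t i = T i.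
Proof. by move=> ip; rewrite /periodic size_t modn_small. Qed.

Section Forward.
Hypothesis upper : admissible_upper.

(** The increment of the last digit turns the weak upper condition into a strict
    one for the suffixes of [t] itself. *)
Lemma admissible_suffix_lt s j : (0 < s)%N -> (s + j)%N = p.-1 ->
  (forall i, (i < j)%N -> T (s + i)%N = T i) -> (T (s + j)%N < T j)%N.
Proof.
move=> s0 sj eqj; have := @upper s j.
rewrite thlo //; last by lia.
rewrite thlo //; last by lia.
rewrite sj prednK // eqxx.
have -> : (j.+1 == p) = false by apply/eqP; lia.
rewrite addn0 addn1; apply; [lia|lia|move=> i lti].
rewrite thlo //; last by lia.
rewrite thlo //; last by lia.
rewrite eqj //; case: eqP; case: eqP; lia.
Qed.

Lemma periodic_shiftle : shiftle (periodic t).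
Proof.
move=> n m; rewrite periodicD => eqm.
have {}eqm i : (i < m)%N -> periodic t (n %% p + i)%N = periodic t i.
  by move=> lti; rewrite -periodicD eqm.
have sp : (n %% p < p)%N by rewrite ltn_mod.
move: (n %% p)%N sp eqm => s sp eqm {n}.
have [->|s0] := posnP s; first by rewrite add0n.
have strict : (p.-1 - s < m)%N -> (periodic t (s + (p.-1 - s)) < periodic t (p.-1 - s))%N.
  move=> lt_m; rewrite !periodic_small; try lia.
  apply: admissible_suffix_lt => //; first by lia.
  move=> i lti; have im : (i < m)%N by lia.
  by rewrite -!periodic_small ?eqm //; lia.
have [lt_m|le_m] := ltnP (p.-1 - s) m.
  by have := strict lt_m; rewrite eqm // ltnn.
rewrite !periodic_small; try lia.
have eqT i : (i < m)%N -> T (s + i)%N = T i.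
  by move=> lti; have := eqm i lti; rewrite !periodic_small //; lia.
have := @upper s m sp; rewrite thlo //; last by lia.
rewrite thlo //; last by lia.
have -> : (m.+1 == p) = false by apply/eqP; lia.
rewrite addn0 => H; apply: (leq_trans (leq_addr _ _)); apply: H; first by lia.
move=> i lti; rewrite thlo //; last by lia.
rewrite thlo //; last by lia.
by rewrite eqT //; case: eqP; case: eqP; lia.
Qed.

Hypothesis lower : admissible_lower.

Lemma periodic_reflge : reflge N (periodic t).
Proof.
move=> n m; rewrite periodicD => eqm.
have {}eqm i : (i < m)%N -> (N.-1 - periodic t i)%N = periodic t (n %% p + i)%N.
  by move=> lti; rewrite -periodicD eqm.
have sp : (n %% p < p)%N by rewrite ltn_mod.
move: (n %% p)%N sp eqm => s sp eqm {n}.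
have [mp|pm] := ltnP m p.
  rewrite periodic_small //; apply: lower => // i lti.
  by rewrite -periodic_small ?eqm //; apply: ltn_trans mp.
have := eqm (m %% p)%N (leq_trans (ltn_pmod _ p0) pm).
by rewrite !(addnC s) -periodicD /periodic size_t modn_mod => ->.
Qed.

Hypotheses (t_digits : forall i, (i < p)%N -> (nth 0 t i < N)%N).
Hypothesis (t_last : (nth 0 t p.-1 < N.-1)%N).

Lemma theta_leN i : (th i <= N.-1)%N.
Proof. exact: (theta_le p0 size_t t_digits t_last). Qed.

(** The strict lower bounds come from the last digit: a suffix of [t] that ties
    with the reflected prefix gains the increment. *)
Lemma block_order_base : block_order N th p.
Proof.
have lo i : (i.+1 < p)%N -> th i = T i.
  by move=> lti; rewrite thlo ?(ltn_eqF lti) ?addn0 // ltnW.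
have hi : th p.-1 = (T p.-1).+1 by rewrite thlo ?prednK // eqxx addn1.
have lower' s : (s < p)%N -> exists2 j, (s + j < p)%N &
    (forall i, (i < j)%N -> th (s + i)%N = N.-1 - th i)%N /\ (N.-1 - th j < th (s + j)%N)%N.
  move=> sp.
  have ex : exists j, (s + j < p)%N
      && ((th (s + j)%N != N.-1 - th j)%N || ((s + j).+1 == p)).
    exists (p.-1 - s)%N; apply/andP; split; first by lia.
    by apply/orP; right; apply/eqP; lia.
  case: (ex_minnP ex) => j /andP[jp jP] minj.
  have eqj i : (i < j)%N -> (th (s + i)%N = N.-1 - th i)%N /\ ((s + i).+1 < p)%N.
    move=> ltij; have : ~~ ((s + i < p)%N
      && ((th (s + i)%N != N.-1 - th i)%N || ((s + i).+1 == p))).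
      by apply: contraL ltij => /minj; rewrite -leqNgt.
    have -> : (s + i < p)%N by lia.
    rewrite /= negb_or negbK => /andP[/eqP-> ne]; split=> //.
    by rewrite ltn_neqAle ne /=; lia.
  exists j => //; split; first by move=> i /eqj[].
  have le_j : (N.-1 - T j <= T (s + j))%N.
    rewrite -(periodic_small jp); apply: lower => //; first by lia.
    move=> i lti; have [e1 e2] := eqj i lti.
    rewrite periodic_small; last by lia.
    by rewrite -(lo (s + i)%N) // e1 lo //; lia.
  have [sj|sj] := eqVneq (s + j).+1 p.
    have -> : (s + j = p.-1)%N by lia.
    rewrite hi; have -> : p.-1 = (s + j)%N by lia.
    rewrite ltnS; apply: leq_trans le_j; rewrite leq_sub2l //.
    by rewrite thlo ?leq_addr //; lia.
  have sj' : ((s + j).+1 < p)%N by rewrite ltn_neqAle sj.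
  rewrite (negbTE sj) orbF in jP.
  rewrite ltn_neqAle eq_sym jP /= !lo //; lia.
split.
- move=> s j s0 sj eqj; apply: upper => //; lia.
- by move=> s /andP[_ sp]; apply: lower'.
- by have [j jp H] := lower' 0%N p0; exists j.
Qed.

Lemma theta_block_order m : block_order N th (2 ^ m * p).
Proof.
elim: m => [|m IHm]; first by rewrite mul1n; apply: block_order_base.
rewrite expnS -mulnA mul2n -addnn; apply: block_order_double IHm => //.
- exact: theta_leN.
- by rewrite muln_gt0 expn_gt0.
- by move=> i lti; rewrite theta_hi.
Qed.

Lemma theta_cover i : exists2 q, (i < q)%N & block_order N th q.
Proof.
have [m lti] := pow2_cover p0 i; exists (2 ^ m * p)%N => //.
exact: theta_block_order.
Qed.

End Forward.

Lemma admissibleP : (nth 0 t p.-1 < N.-1)%N ->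
  admissible N t <-> admissible_lower /\ admissible_upper.
Proof.
move=> t_last; have szr s : size (drop s t ++ take s t) = p.
  by rewrite size_cat addnC -size_cat cat_take_drop.
have szw s : (s < p)%N -> size (drop s (block_plus t) ++ reflection N (take s t)) = p.
  move=> sp; rewrite size_cat size_drop size_block_plus size_t // size_reflection.
  by rewrite size_take size_t sp subnK // ltnW.
have szb : size (block_plus t) = p by rewrite size_block_plus size_t.
have lowerE s : (s < p)%N -> lexle (reflection N t) (drop s t ++ take s t) <->
    (forall j, (j < p)%N -> (forall i, (i < j)%N -> N.-1 - T i = periodic t (s + i))%N ->
      (N.-1 - T j <= periodic t (s + j))%N).
  move=> sp; rewrite lexleP ?szr size_reflection ?size_t //.
  split=> H j jp eqj.
    have := H j jp; rewrite nth_reflection ?size_t // nth_rotation //; apply=> i ltij.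
    have ip : (i < p)%N by apply: ltn_trans jp.
    by rewrite nth_reflection ?size_t // nth_rotation // eqj.
  rewrite nth_reflection ?size_t // nth_rotation //; apply: H => // i ltij.
  have ip : (i < p)%N by apply: ltn_trans jp.
  by have := eqj i ltij; rewrite nth_reflection ?size_t // nth_rotation.
have upperE s : (s < p)%N ->
   lexle (drop s (block_plus t) ++ reflection N (take s t)) (block_plus t) <->
    (forall j, (j < p)%N -> (forall i, (i < j)%N -> th (s + i) = th i)%N ->
      (th (s + j) <= th j)%N).
  have bE i : (i < p)%N -> nth 0%N (block_plus t) i = th i.
    by move=> ip; rewrite nth_block_plus ?size_t // thlo.
  move=> sp; rewrite lexleP ?szw ?szb //.
  split=> H j jp eqj.
    have := H j jp; rewrite theta_window // bE //; apply=> i ltij.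
    have ip : (i < p)%N by apply: ltn_trans jp.
    by rewrite theta_window // bE // eqj.
  rewrite theta_window // bE //; apply: H => // i ltij.
  have ip : (i < p)%N by apply: ltn_trans jp.
  by have := eqj i ltij; rewrite theta_window // bE.
split=> [[_ adm]|[lo up]].
  split=> s j sp; first by case: (adm s); rewrite ?size_t // => /(lowerE s sp) H _; apply: H.
  by case: (adm s); rewrite ?size_t // => _ /(upperE s sp) H; apply: H.
split; first by rewrite -nth_last size_t.
move=> s; rewrite size_t => sp; split; first by apply/(lowerE s sp) => j; apply: lo.
by apply/(upperE s sp) => j; apply: up.
Qed.

End Admissible.

(** * The threshold G_N and bases with a given expansion *)

Section GoldenRatio.
Variable R : realType.

Lemma GN_odd k : GN R k.*2.+1 = k%:R + 1.
Proof. by rewrite /GN /= odd_double uphalf_double. Qed.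

Lemma GN_even k : (0 < k)%N ->
  k%:R < GN R k.*2 < k%:R + 1 /\ GN R k.*2 * (GN R k.*2 - k%:R) = k%:R.
Proof.
move=> k0; rewrite /GN odd_double doubleK; set K := k%:R.
have K0 : 0 < K by rewrite ltr0n.
set S := Num.sqrt _; have S0 : 0 <= S by rewrite sqrtr_ge0.
have S2 : S ^+ 2 = K ^+ 2 + 4 * K.
  by rewrite sqr_sqrtr // addr_ge0 ?sqr_ge0 // mulr_ge0 // ltW.
split; last by field: S2.
by apply/andP; split; nra.
Qed.

Lemma nat_parity n : exists k, n = k.*2.+1 \/ n = k.*2.
Proof.
exists n./2; rewrite -{1 3}(odd_double_half n).
by case: (odd n); [left|right].
Qed.

Lemma GN_bounds N : (1 < N)%N -> 1 < GN R N <= N%:R.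
Proof.
have [k [->|->]] := nat_parity N => N1.
  have k0 : (1 : R) <= k%:R by rewrite ler1n; lia.
  by rewrite GN_odd -natr1 -muln2 natrM; apply/andP; split; lra.
have k0 : (1 : R) <= k%:R by rewrite ler1n; lia.
have [|/andP[G1 G2] _] := @GN_even k; first by lia.
have -> : k.*2%:R = k%:R * 2 :> R by rewrite -muln2 natrM.
by apply/andP; split; lra.
Qed.

(** The digits are forced: at [G_N] with [N = 2k + 1] every digit is [k], and with
    [N = 2k] the digits alternate between [k] and [k - 1]. Larger digits make the
    remainder negative, and smaller ones fall below the reflection of the first
    two digits. These sequences are the expansions of [G_N], with remainders in
    ]0, 1]. *)
Lemma reflge_remainder_le1 N a : (1 < N)%N -> reflge N a ->
  (forall n, 0 < remainder a (GN R N) n) -> forall n, remainder a (GN R N) n <= 1.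
Proof.
move=> N1 refl pos.
have an n : (N.-1 - a 0 <= a n)%N by have := refl n 0%N; rewrite addn0; apply.
have a0 := an 0%N.
have [k [Nk|Nk]] := nat_parity N; rewrite {}Nk /= in N1 refl pos an a0 *.
  rewrite GN_odd in pos * => n.
  have a0k : a 0%N = k.
    have := pos 1%N; rewrite /= mulr1 natr1 subr_gt0 ltr_nat; lia.
  suff -> : remainder a (k%:R + 1 : R) n = 1 by [].
  elim: n => // n IHn; have := pos n.+1; have := an n.
  rewrite /= IHn mulr1 natr1 subr_gt0 ltr_nat a0k => le1 le2.
  have -> : a n = k by lia.
  by ring.
have [|/andP[G1 G2] GE] := @GN_even k; first by lia.
set G := GN R k.*2 in pos G1 G2 GE *.
have a0k : a 0%N = k.
  have := pos 1%N; rewrite /= mulr1 subr_gt0 => /lt_trans/(_ G2).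
  by rewrite natr1 ltr_nat; lia.
have step m : remainder a G m = 1 -> (k <= a m)%N ->
    [/\ remainder a G m.+1 = G - k%:R, a m.+1 = k.-1 & remainder a G m.+2 = 1].
  move=> r1 ka; have := pos m.+1; have := pos m.+2; rewrite /= r1 mulr1 => p2 p1.
  have am : a m = k.
    have := lt_trans (_ : (a m)%:R < G) G2; rewrite -subr_gt0 => /(_ p1).
    by rewrite natr1 ltr_nat; lia.
  rewrite am GE subr_gt0 ltr_nat in p2; rewrite am GE.
  have am1 : a m.+1 = k.-1 by have := an m.+1; lia.
  split=> //; rewrite am1 -[in X in X - _](prednK (_ : (0 < k)%N)); last by lia.
  by rewrite -natr1; ring.
have H m : remainder a G m.*2 = 1 /\ (k <= a m.*2)%N.
  elim: m => [|m [IH1 IH2]]; first by rewrite a0k.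
  have [_ a1 r2] := step _ IH1 IH2; rewrite doubleS; split=> //.
  have [_ a1' _] := step 0%N erefl (eq_leq (esym a0k)).
  have := refl m.*2.+1 1%N; rewrite addn1 a1'; have -> : (k.*2.-1 - k.-1 = k)%N by lia.
  by apply=> -[|//] _; rewrite addn0 a1 a0k; lia.
move=> n; have [m [->|->]] := nat_parity n; last by case: (H m) => ->.
by have [/step st /st[-> _ _]] := H m; lra.
Qed.

End GoldenRatio.

Section Bases.
Variable R : realType.

(** A base equal to [N] would have all remainders equal to 1 and hence all digits
    equal to [N - 1]. *)
Lemma exists_base N a : (1 < N)%N -> (forall i, (a i < N)%N) ->
    shiftle a -> reflge N a ->
    (forall n, exists2 m, (n <= m)%N & (0 < a m)%N) ->
    (exists i, (a i < N.-1)%N) ->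
  exists2 b : R, GN R N <= b < N%:R & is_expansion N b a.
Proof.
move=> N1 aN sa ra a_inf [i ai].
have [b /andP[Gb bN] eb] :=
  exists_expansion (GN_bounds R N1) aN sa a_inf (reflge_remainder_le1 N1 ra).
exists b => //; rewrite Gb lt_def bN andbT /=; apply/eqP=> Nb.
have r1 n : remainder a b n = 1.
  apply/eqP; rewrite eq_le; have [_ /andP[_ ->]] := eb n; elim: n => //= n IHn.
  have := aN n; rewrite -(ler_nat R) -natr1 Nb => le1.
  have b0 : (0 : R) < b by rewrite -Nb ltr0n ltnW.
  have := ler_pM2l b0 1 (remainder a b n); rewrite IHn mulr1 => /idP.
  by lra.
have := r1 i.+1; rewrite /= r1 mulr1 => /eqP; rewrite subr_eq -Nb nat1r eqr_nat.
by lia.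
Qed.

(** Otherwise the remainders for [b] dominate those for [b'], so the larger digit
    would be allowed in base [b]. *)
Lemma expansion_base_lt N a a' (b b' : R) n : 0 < b -> is_expansion N b a ->
    is_expansion N b' a' -> (forall i, (i < n)%N -> a i = a' i) ->
  (a n < a' n)%N -> b < b'.
Proof.
move=> b0 ea ea' eqa lta; rewrite ltNge; apply/negP=> b'b.
have b'0 : 0 < b'.
  have [_ /andP[r' _]] := ea' n.+1; have [_ /andP[r0 _]] := ea' n.
  have : 0 < b' * remainder a' b' n.
    by move: r'; rewrite /= subr_gt0; apply: le_lt_trans.
  by rewrite pmulr_lgt0.
have le_r : remainder a' b' n.+1 <= remainder a' b n.+1.
  by apply: remainder_mono => [|i _]; rewrite ?b'0 //; have [_ /andP[]] := ea' i.
have [_ /andP[r'0 _]] := ea' n.+1; have [_ /andP[_ r1]] := ea n.+1.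
have := lt_le_trans r'0 le_r; move: r1; rewrite /= -(remainder_ext _ eqa).
by move: lta; rewrite -(ler_nat R) -natr1; lra.
Qed.

(** Over each period the deviation of the remainder from 1 is multiplied by
    [b ^+ p]; remainders are bounded, so the remainder is 1 after one period,
    and this is a monic equation for [b]. *)
Lemma periodic_base_algebraic N p a (b : R) : (0 < p)%N -> 1 < b -> is_expansion N b a ->
  (forall i, a (p + i)%N = a i) -> algebraicOver (ratr : rat -> R) b.
Proof.
move=> p0 b1 eb per.
have rp : remainder a b p = 1.
  apply/eqP; apply: contraT => rp1.
  have b0 : 0 < b by apply: lt_trans b1.
  have bV : 0 < b^-1 < 1 by rewrite invr_gt0 b0 invf_lt1.
  have [k /(_ k (leqnn k))] := expr_small (`|remainder a b p - 1|^-1) bV.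
  have d0 : 0 < `|remainder a b p - 1| by rewrite normr_gt0 subr_eq0.
  rewrite exprVn ltr_pdivrMr ?exprn_gt0 // mul1r ltNge; case/negP.
  rewrite -[leRHS]mul1r ler_pdivlMr //.
  have := remainderD a b p k; rewrite (@remainder_ext _ _ a) => [E|i _]; last exact: per.
  have := eb (p + k)%N; have := eb k => -[_ /andP[h1 h2]] [_ /andP[h3 h4]].
  have bk0 : 0 <= b ^+ k by rewrite exprn_ge0 // ltW.
  rewrite -[X in X * _ <= _](ger0_norm bk0) -normrM ler_norml; lra.
pose fix P n : {poly rat} := if n is m.+1 then 'X * P m - (a m)%:R%:P else 1.
have PE n : (map_poly ratr (P n)).[b] = remainder a b n.
  elim: n => [|n IHn] /=; first by rewrite rmorph1 hornerC.
  rewrite rmorphB rmorphM /= map_polyX map_polyC /= hornerD hornerN hornerM hornerX.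
  by rewrite hornerC IHn ratr_nat.
have sizeP n : size (P n) = n.+1.
  elim: n => [|n IHn] /=; first by rewrite size_poly1.
  have P0 : P n != 0 by rewrite -size_poly_gt0 IHn.
  rewrite size_polyDl mulrC size_mulX // IHn // size_polyN.
  exact: leq_ltn_trans (size_polyC_leq1 _) _.
exists (P p - 1).
  rewrite -size_poly_gt0 size_polyDl sizeP // size_polyN size_poly1; lia.
by rewrite /root rmorphB /= hornerD hornerN PE rp rmorph1 hornerC subrr.
Qed.

End Bases.

(** * From the expansions back to admissibility *)

Section Converse.
Variables (R : realType) (N p : nat) (t : seq nat).
Hypotheses (N2 : (1 < N)%N) (p0 : (0 < p)%N) (size_t : size t = p).
Hypotheses (t_digits : forall i, (i < p)%N -> (nth 0 t i < N)%N).
Hypothesis (t_last : (nth 0 t p.-1 < N.-1)%N).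
Local Notation T := (nth 0%N t).
Local Notation th := (theta N (block_plus t)).
Local Notation per := (periodic t).
Let thlo := theta_lo N p0 size_t.
Let per_small := periodic_small size_t.

Lemma theta_second_block s i : (s < p)%N -> (i < p)%N ->
  th (p + s + i)%N = (N.-1 - per (s + i))%N.
Proof.
move=> sp ip; rewrite -addnA; have [sip|psi] := ltnP (s + i) p.
  have := theta_hi N p0 size_t (m := 0) (i := (s + i)%N); rewrite mul1n => -> //.
  rewrite thlo // per_small //; case: eqP => [e|_]; last by rewrite !addn0.
  have si : (s + i)%N = p.-1 by rewrite -e.
  by rewrite si; move: t_last => tl; rewrite -[N.-1 in RHS](subnKC tl); lia.
have [k sik] : exists k, (s + i = p + k)%N by exists (s + i - p)%N; lia.
have ks : (k.+1 < p)%N by lia.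
have -> : (p + (s + i) = 2 ^ 1 * p + k)%N by rewrite sik expn1; lia.
rewrite theta_hi //; last by lia.
rewrite thlo; last by lia.
have -> : (k.+1 == p) = false by apply/eqP; lia.
have -> : (k.+1 == 2 ^ 1 * p)%N = false by apply/eqP; lia.
by rewrite !addn0 sik /periodic size_t modnDl modn_small //; lia.
Qed.

Lemma sum_periodic s : (s < p)%N -> (\sum_(i < p) per (s + i) = \sum_(i < p) T i)%N.
Proof.
move=> sp.
have sumE (u : seq nat) : size u = p -> (\sum_(i < p) nth 0 u i = sumn u)%N.
  by move=> <-; rewrite sumnE (big_nth 0%N) big_mkord.
rewrite sumE // -{2}(cat_take_drop s t) sumn_cat addnC -sumn_cat -sumE; last first.
  by rewrite size_cat addnC -size_cat cat_take_drop.
by apply: eq_bigr => i _; rewrite (nth_rotation p0 size_t).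
Qed.

(** Compare digit sums: a rotation of [t] has the digit sum [S] of [t], and its
    reflection the digit sum [S + 1] of the incremented block, so the total
    [p * N.-1] is [2 * S + 1]. *)
Lemma theta_balance s : (s < p)%N ->
  (forall i, (i < p)%N -> N.-1 - per (s + i) = th i)%N -> odd (p * N.-1).
Proof.
move=> sp E.
have perN i : (per i <= N.-1)%N.
  rewrite /periodic size_t; have := t_digits (ltn_pmod i p0); lia.
have : (\sum_(i < p) (N.-1 - per (s + i)) + \sum_(i < p) per (s + i) = p * N.-1)%N.
  rewrite -big_split /= -[in RHS](card_ord p) -sum_nat_const.
  by apply: eq_bigr => i _; rewrite subnK.
rewrite sum_periodic //.
have -> : (\sum_(i < p) (N.-1 - per (s + i)) = \sum_(i < p) T i + 1)%N.
  rewrite (eq_bigr (fun i : 'I_p => T i + (i.+1 == p :> nat))%N); last first.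
    by move=> i _; rewrite E // thlo.
  rewrite big_split /=; congr (_ + _)%N.
  have lt_p1 : (p.-1 < p)%N by rewrite prednK.
  rewrite (bigD1 (Ordinal lt_p1)) //= prednK // eqxx big1 // => i ne.
  case: eqP => // ip; case/eqP: ne; apply: val_inj => /=; lia.
move=> <-; rewrite addnAC addnn oddD odd_double //.
Qed.

Variables bL bU : R.
Hypotheses (GbL : GN R N <= bL) (GbU : GN R N <= bU).
Hypotheses (eL : is_expansion N bL per) (eU : is_expansion N bU th).

Let bL1 : 1 < bL.
Proof. by have /andP[G1 _] := GN_bounds R N2; apply: lt_le_trans GbL. Qed.
Let bU0 : 0 < bU.
Proof.
have /andP[G1 _] := GN_bounds R N2.
by apply: lt_le_trans GbU; apply: lt_trans G1.
Qed.
Let th_shift : shiftle th. Proof. exact: expansion_shiftle bU0 eU. Qed.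

(** The shift condition for theta bounds the lower admissibility condition by the
    incremented block, which leaves open that the reflection of a rotation of [t]
    is the incremented block itself. Then [N = 2k] by [theta_balance], and the
    first digit of [t] is at least [k] as the base is at least [G_N]. One more
    digit of the shift condition forces the rotation to start at the last digit
    and [t] to be [(k (k-1))^m (k-1)]. The sequence of period [t] lies below the
    expansion [(k (k-1))^oo] of [G_N], so it has no base above [G_N]. *)
Lemma no_self_reflection s : (s < p)%N ->
  ~ (forall i, (i < p)%N -> N.-1 - per (s + i) = th i)%N.
Proof.
move=> sp E; have := theta_balance sp E.
have [k [Nk|Nk]] := nat_parity N; first by rewrite Nk /= oddM odd_double andbF.
rewrite oddM => /andP[p_odd _].
have k0 : (0 < k)%N by lia.
have [/andP[G1 G2] GE] := GN_even R k0; rewrite -Nk in G1 G2 GE.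
have per_lt i : (per i < N)%N by rewrite /periodic size_t t_digits ?ltn_pmod.
have T0k : (k <= T 0)%N.
  have [_ /andP[_]] := eL 1%N; rewrite /= mulr1 per_small // => r1.
  rewrite -ltnS -(ltr_nat R) -natr1.
  by apply: (lt_le_trans G1); apply: (le_trans GbL); rewrite -lerBlDl.
have E0 : (N.-1 - T s = th 0)%N by rewrite -(E 0%N p0) addn0 per_small.
have Ts := t_digits sp; have T0N := t_digits p0.
(* The shift by [p + s] agrees with theta on [p] digits; this is the next one. *)
have shp : (th (2 * p + s) <= th p)%N.
  have := @th_shift (p + s)%N p; rewrite (_ : (p + s + p = 2 * p + s)%N); last by lia.
  by apply=> i ip; rewrite theta_second_block // E.
have thp : th p = (N.-1 - th 0 + (1 == p))%N.
  by have := theta_hi N p0 size_t (m := 0) (i := 0); rewrite mul1n addn0 => ->.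
have ths : th (2 * p + s)%N = (N.-1 - th s)%N.
  have := theta_hi N p0 size_t (m := 1) (i := s); rewrite expn1 => ->; last by lia.
  have -> : (s.+1 == 2 * p)%N = false by apply/eqP; lia.
  by rewrite addn0.
have [p1|p1] := eqVneq p 1%N.
  have s0 : s = 0%N by lia.
  by rewrite thlo // p1 s0 /= in E0; rewrite s0 in Ts; lia.
have p2 : (1 < p)%N by lia.
have th0 : th 0%N = T 0%N by rewrite thlo // eq_sym (negbTE p1) addn0.
have thsT := thlo sp.
have thsN := theta_le p0 size_t t_digits t_last s.
rewrite ths thp th0 in shp; rewrite th0 in E0.
have neq1 : (1 == p)%N = false by rewrite eq_sym (negbTE p1).
rewrite neq1 addn0 in shp.
have [sp1|sp1] := eqVneq s.+1 p; last by rewrite (negbTE sp1) in thsT; lia.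
rewrite sp1 eqxx in thsT.
have T0 : T 0%N = k by lia.
have s_p1 : s = p.-1 by lia.
have Tlast : T p.-1 = k.-1 by rewrite -s_p1; lia.
have alt i : (i.+2 < p)%N -> T i.+1 = (N.-1 - T i)%N.
  move=> lti; have := E i.+1; rewrite thlo; last by lia.
  have -> : (i.+2 == p) = false by apply/eqP; lia.
  have -> : (s + i.+1 = p + i)%N by lia.
  rewrite /per size_t modnDl modn_small ?addn0; last by lia.
  by move=> <- //; lia.
have Talt i : (i.*2.+1 < p)%N -> T i.*2 = k /\ ((i.*2.+2 < p)%N -> T i.*2.+1 = k.-1).
  elim: i => [|i IHi] lti.
    by rewrite T0; split=> // lt2; rewrite alt // T0; lia.
  have [|e1 e2] := IHi; first by lia.
  have e3 : T i.+1.*2 = k by rewrite doubleS alt; [rewrite e2; lia|lia].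
  by split=> // lt2; rewrite alt // e3; lia.
(* At a base above [G_N] a pair of digits [k], [k - 1] leads from a remainder at
   least 1 to another one; the last digit [k - 1] then leaves more than 1. *)
have bLk : k%:R <= bL * (bL - k%:R) :> R.
  rewrite -[leLHS]GE; apply: ler_pM; rewrite ?subr_ge0 ?lerD2r // ltW //.
  by rewrite (lt_trans _ G1) // ltr0n.
have r_ge1 i : (i.*2 < p)%N -> 1 <= remainder per bL i.*2.
  elim: i => [|i IHi] lti //; rewrite doubleS in lti *.
  have r1 : 1 <= remainder per bL i.*2 by apply: IHi; lia.
  have [|e1 e2] := Talt i; first by lia.
  rewrite /= !per_small ?e1 ?e2 //; try lia.
  rewrite -(prednK k0) -natr1 in bLk *; nra.
have [m pm] : exists m, p = m.*2.+1.
  by exists p./2; rewrite -[LHS]odd_double_half p_odd.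
have r1 : 1 <= remainder per bL m.*2 by apply: r_ge1; lia.
have [_ /andP[_]] := eL p; rewrite pm /= per_small; last by lia.
have -> : T m.*2 = k.-1 by rewrite -Tlast pm.
have bLr : bL <= bL * remainder per bL m.*2 by rewrite ler_peMr // ltW // (lt_trans _ bL1).
have kb : k.-1%:R + 1 < bL by rewrite natr1 prednK // (lt_le_trans G1).
by rewrite leNgt => /negP; apply; lra.
Qed.

Lemma expansions_admissible : admissible_lower N p t /\ admissible_upper N p t.
Proof.
split; last by move=> s j _ _; apply: th_shift.
move=> s j sp jp eqj; rewrite leqNgt; apply/negP=> lt_j.
have TN i : (i < p)%N -> (T i <= N.-1)%N by move/t_digits; lia.
have ip i : (i < j)%N -> (i < p)%N by move/ltn_trans; apply.
have pre i : (i < j)%N -> (N.-1 - per (s + i) = th i)%N.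
  move=> lti; rewrite -eqj // subKn ?TN ?ip // thlo ?ip //.
  have -> : (i.+1 == p) = false by apply/eqP; lia.
  by rewrite addn0.
have := @th_shift (p + s)%N j; rewrite theta_second_block // thlo // => le_j.
have {}le_j : (N.-1 - per (s + j) <= T j + (j.+1 == p))%N.
  by apply: le_j => i lti; rewrite theta_second_block //; [exact: pre|exact: ip].
have Tj := TN j jp.
have [jp1|jp1] := eqVneq j.+1 p; last by rewrite (negbTE jp1) addn0 in le_j; lia.
rewrite jp1 eqxx in le_j.
apply: (no_self_reflection sp) => i lti.
have [|ij] := ltnP i j; first exact: pre.
have -> : i = j by lia.
by rewrite thlo // jp1 eqxx; lia.
Qed.

End Converse.

(** * Transcendence of the base of theta *)

Section AlgebraicClosure.
Variable R : realFieldType.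

Lemma algebraicX (u : R) n : algebraicOver (ratr : rat -> R) u ->
  algebraicOver (ratr : rat -> R) (u ^+ n).
Proof.
move=> alg_u; elim: n => [|n IHn]; first by rewrite expr0; apply: algebraic1.
by rewrite exprS; apply: algebraic_mul.
Qed.

Lemma algebraic_nat n : algebraicOver (ratr : rat -> R) n%:R.
Proof. by rewrite -(ratr_nat R n); apply: algebraic_id. Qed.

End AlgebraicClosure.

Section ThetaTranscendence.
Variables (R : realType) (N p : nat) (th : nat -> nat) (b : R).
Hypotheses (p0 : (0 < p)%N) (b1 : 1 < b) (bN : b < N%:R).
Hypothesis th_le : forall i, (th i <= N.-1)%N.
Hypothesis th_hi : forall m i, (i < 2 ^ m * p)%N ->
  th (2 ^ m * p + i)%N = (N.-1 - th i + (i.+1 == 2 ^ m * p))%N.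
Hypothesis eb : is_expansion N b th.

Let x := b^-1.
Let y := x ^+ p.
Let mid : R := N.-1%:R / 2.

(** Subtracting [mid], the fixed point of the reflection, turns the reflection of
    digits into a change of sign. *)
Definition centered_sum n : R := \sum_(i < n) ((th i)%:R - mid) * x ^+ i.+1.

Let b0 : 0 < b. Proof. exact: lt_trans b1. Qed.
Let x0 : 0 < x. Proof. by rewrite invr_gt0. Qed.
Let x1 : x < 1. Proof. by rewrite invf_lt1. Qed.
Let bx : b * x = 1. Proof. by rewrite mulfV // gt_eqF. Qed.

Lemma centered_sum_double m (q := (2 ^ m * p)%N) :
  centered_sum (q + q) = (1 - x ^+ q) * centered_sum q + x ^+ q ^+ 2.
Proof.
have q0 : (0 < q)%N by rewrite muln_gt0 expn_gt0.
have lt_q1 : (q.-1 < q)%N by rewrite prednK.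
rewrite /centered_sum big_split_ord /=.
have -> : \sum_(i < q) ((th (q + i)%N)%:R - mid) * x ^+ (q + i).+1 =
  \sum_(i < q) (- x ^+ q * (((th i)%:R - mid) * x ^+ i.+1)
                + (i.+1 == q :> nat)%:R * x ^+ (q + i).+1).
  apply: eq_bigr => i _; rewrite th_hi // natrD natrB //.
  by rewrite -addnS exprD /mid; field.
rewrite big_split /= -mulr_sumr.
have -> : \sum_(i < q) (i.+1 == q :> nat)%:R * x ^+ (q + i).+1 = x ^+ q ^+ 2 :> R.
  rewrite (bigD1 (Ordinal lt_q1)) //= prednK // eqxx mul1r big1 ?addr0.
    by rewrite -addnS prednK // -exprM muln2 -addnn.
  move=> i ne; case: eqP => [iq|]; last by rewrite mul0r.
  by case/eqP: ne; apply: val_inj => /=; have := congr1 predn iq.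
by ring.
Qed.

(** The recursion of [centered_sum_double] is linear with factors
    [1 - y ^+ (2 ^ m)] and inhomogeneous term [y ^+ (2 ^ m) ^+ 2]; the particular
    solution [(1 + y ^+ (2 ^ m)) / 2] makes it homogeneous. *)
Lemma centered_sum_tm m : centered_sum (2 ^ m * p) =
  tm_prod y m * (centered_sum p - (1 + y) / 2) + (1 + y ^+ (2 ^ m)) / 2.
Proof.
elim: m => [|m IHm]; first by rewrite expn0 mul1n /tm_prod big_ord0 expr1 mul1r subrK.
have -> : (2 ^ m.+1 * p = 2 ^ m * p + 2 ^ m * p)%N by rewrite expnS; lia.
have xq : x ^+ (2 ^ m * p) = y ^+ (2 ^ m) by rewrite mulnC exprM.
by rewrite centered_sum_double IHm tm_prodS xq expnSr exprM; field.
Qed.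

Lemma centered_sum_remainder n :
  centered_sum n = 1 - x ^+ n * remainder th b n - mid / (b - 1) * (1 - x ^+ n).
Proof.
have b_1 : b - 1 != 0 by rewrite subr_eq0 gt_eqF.
elim: n => [|n IHn]; first by rewrite /centered_sum big_ord0 /= expr0; field.
rewrite /centered_sum big_ord_recr -/(centered_sum n) IHn /= exprS.
have -> : x * x ^+ n * (b * remainder th b n - (th n)%:R) =
   x ^+ n * remainder th b n * (b * x) - x * x ^+ n * (th n)%:R by ring.
have -> : mid / (b - 1) * (1 - x * x ^+ n) =
    mid / (b - 1) * (1 - x ^+ n) + mid * x * x ^+ n.
  have -> : x ^+ n = b * x * x ^+ n by rewrite bx mul1r.
  have := bx; by move: (x ^+ n) => z E; field: E.
by rewrite bx; ring.
Qed.

(** [A = B * W] will hold for [W] the infinite product of the factors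
    [1 - y ^+ (2 ^ j)]. Moreover [A] vanishes only for [b = N], so that [b < N]
    excludes the degenerate case [B = 0]. *)
Let A : R := (1 - N.-1%:R / (b - 1)) / 2.
Let B : R := centered_sum p - (1 + y) / 2.

Lemma theta_product_limit :
  exists C, forall m, `|A - tm_prod y m * B| <= C * y ^+ (2 ^ m).
Proof.
exists (1 + `|A|) => m.
have := centered_sum_tm m; rewrite centered_sum_remainder -/B mulnC exprM -/y => E.
set Y := y ^+ (2 ^ m) in E *; set P := tm_prod y m * B in E *.
have Y0 : 0 <= Y by rewrite !exprn_ge0 // ltW.
have -> : A - P = Y * (remainder th b (p * 2 ^ m) + A).
  have -> : P = 1 - Y * remainder th b (p * 2 ^ m) - mid / (b - 1) * (1 - Y) - (1 + Y) / 2.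
    by rewrite E addrK.
  by rewrite /A /mid; field; rewrite subr_eq0 gt_eqF.
rewrite normrM (ger0_norm Y0) mulrC ler_wpM2r //.
apply: (le_trans (ler_normD _ _)); rewrite lerD2r.
by have [_ /andP[r0 r1]] := eb (p * 2 ^ m)%N; rewrite gtr0_norm.
Qed.

Let y01 : 0 < y < 1.
Proof. by rewrite exprn_gt0 //= exprn_ilt1 ?ltW // -lt0n. Qed.

Let A_neq0 : A != 0.
Proof.
have b_1 : 0 < b - 1 by rewrite subr_gt0.
have N0 : (0 < N)%N by rewrite -(ltr0n R) (lt_trans b0).
have NN : N%:R = N.-1%:R + 1 :> R by rewrite natr1 prednK.
rewrite mulf_neq0 ?invr_eq0 ?pnatr_eq0 // subr_eq0 lt_eqF //.
by rewrite ltr_pdivlMr // mul1r ltrBlDr -NN.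
Qed.

Let B_neq0 : B != 0.
Proof.
apply/eqP=> B0; have [C limit] := theta_product_limit.
have A0 : 0 < `|A| by rewrite normr_gt0.
have [n /(_ (2 ^ n)%N (ltnW (@ltn_expl 2 n isT)))] := expr_small (C / `|A|) y01.
rewrite mulrAC ltr_pdivrMr // mul1r => lt_A.
by have := limit n; rewrite B0 mulr0 subr0 leNgt lt_A.
Qed.

Theorem theta_base_transcendental : ~ algebraicOver (ratr : rat -> R) b.
Proof.
move=> alg_b; have alg2 := algebraic_nat R 2; have alg1 := algebraic_nat R 1.
have alg_x : algebraicOver (ratr : rat -> R) x by apply: algebraic_inv.
have alg_y : algebraicOver (ratr : rat -> R) y by apply: algebraicX.
have alg_mid : algebraicOver (ratr : rat -> R) mid.
  by apply: algebraic_div => //; apply: algebraic_nat.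
have alg_A : algebraicOver (ratr : rat -> R) A.
  apply: algebraic_div => //; apply: algebraic_sub => //.
  by apply: algebraic_div; [apply: algebraic_nat|apply: algebraic_sub].
have alg_B : algebraicOver (ratr : rat -> R) B.
  apply: algebraic_sub; last by apply: algebraic_div => //; apply: algebraic_add.
  rewrite /centered_sum; elim/big_ind: _ => [||i _].
  - exact: algebraic0.
  - by move=> u v; apply: algebraic_add.
  apply: algebraic_mul; last exact: algebraicX.
  by apply: algebraic_sub => //; apply: algebraic_nat.
have [C limit] := theta_product_limit.
apply: (@tm_prod_limit_transcendental R y (A / B) (C / `|B|)) => //.
- by rewrite mulf_neq0 // invr_eq0.
- move=> m; have -> : tm_prod y m - A / B = - (A - tm_prod y m * B) / B by field.
  by rewrite normrM normrN normfV mulrAC ler_wpM2r ?invr_ge0.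
- exact: algebraic_div.
Qed.

End ThetaTranscendence.

(** * The equivalence and the nature of the two bases *)

Section Assembly.
Variables (R : realType) (N p : nat) (t : seq nat).
Hypotheses (p0 : (0 < p)%N) (size_t : size t = p).
Local Notation th := (theta N (block_plus t)).

Lemma bases_lt (bL bU : R) : 0 < bL -> is_expansion N bL (periodic t) ->
  is_expansion N bU th -> bL < bU.
Proof.
have p1 : (p.-1 < p)%N by rewrite prednK.
move=> bL0 eL eU; apply: (expansion_base_lt (n := p.-1) bL0 eL eU) => [i lti|].
  have ip : (i < p)%N by apply: ltn_trans p1.
  rewrite (periodic_small size_t) // (theta_lo N p0 size_t) //.
  have -> : (i.+1 == p) = false by rewrite -(prednK p0) eqSS ltn_eqF.
  by rewrite addn0.
by rewrite (periodic_small size_t) // (theta_lo N p0 size_t) // prednK // eqxx addn1.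
Qed.

Hypothesis (N2 : (1 < N)%N).
Hypotheses (t_digits : forall i, (i < p)%N -> (nth 0 t i < N)%N).
Hypothesis (t_last : (nth 0 t p.-1 < N.-1)%N).

Lemma admissible_bases : admissible N t ->
  exists bL bU : R, [/\ GN R N <= bL < N%:R, GN R N <= bU < N%:R,
    is_expansion N bL (periodic t) & is_expansion N bU th].
Proof.
move/(admissibleP p0 size_t t_last) => [lower upper].
have perE i : (i < p)%N -> periodic t i = nth 0%N t i by apply: periodic_small.
have T0 : (0 < nth 0 t 0)%N.
  have : (N.-1 - nth 0 t 0 <= periodic t (0 + 0))%N by apply: lower.
  by rewrite addn0 perE //; lia.
have thlo := theta_lo N p0 size_t.
have th_le := theta_le p0 size_t t_digits t_last.
have p1 : (p.-1 < p)%N by rewrite prednK.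
have per_lt i : (periodic t i < N)%N by rewrite /periodic size_t t_digits ?ltn_pmod.
have per_inf n : exists2 m, (n <= m)%N & (0 < periodic t m)%N.
  by exists (n * p)%N; [rewrite leq_pmulr|rewrite /periodic size_t modnMl].
have per_small_digit : exists i, (periodic t i < N.-1)%N by exists p.-1; rewrite perE.
have [bL GbL eL] := exists_base R N2 per_lt (periodic_shiftle p0 size_t upper)
  (periodic_reflge p0 size_t lower) per_inf per_small_digit.
have th_lt i : (th i < N)%N by have := th_le i; lia.
have th_inf n : exists2 m, (n <= m)%N & (0 < th m)%N.
  exists (2 ^ n * p).-1; last by case: (theta_bounds p0 size_t t_digits t_last n).
  have n_lt : (n < 2 ^ n)%N by apply: ltn_expl.
  by rewrite -ltnS prednK ?muln_gt0 ?expn_gt0 // (leq_trans n_lt) // leq_pmulr.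
have th_small_digit : exists i, (th i < N.-1)%N.
  exists p; have := theta_hi N p0 size_t (m := 0) (i := 0).
  rewrite mul1n addn0 => -> //; rewrite thlo //.
  have tl := t_last; have T0N := t_digits p0.
  by case: eqP => [p_1|_]; [rewrite -p_1 /= in tl|]; lia.
have cover := theta_cover p0 size_t upper lower t_digits t_last.
have [bU GbU eU] := exists_base R N2 th_lt (block_order_shiftle cover)
  (block_order_reflge cover) th_inf th_small_digit.
by exists bL, bU.
Qed.

End Assembly.

Theorem theorem2p3 (R : realType) (N p : nat) (t : seq nat)
  (hN : (2 <= N)%N) (hp : (1 <= p)%N)
  (ht_size : size t = p)
  (ht_digits : all (fun c => (c < N)%N) t)
  (ht_last : (last 0%N t < N.-1)%N) :
  (admissible N t <->
   exists betaL betaU : R,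
     [/\ GN R N <= betaL < N%:R,
         GN R N <= betaU < N%:R,
         quasi_greedy N betaL =1 periodic t &
         quasi_greedy N betaU =1 theta N (block_plus t)]) /\
  (forall betaL betaU : R,
     GN R N <= betaL < N%:R ->
     GN R N <= betaU < N%:R ->
     quasi_greedy N betaL =1 periodic t ->
     quasi_greedy N betaU =1 theta N (block_plus t) ->
     [/\ betaL < betaU, algebraic betaL & transcendental betaU]).
Proof.
have t_digits i : (i < p)%N -> (nth 0 t i < N)%N.
  by rewrite -ht_size => lti; apply: (all_nthP 0%N ht_digits).
have t_last : (nth 0 t p.-1 < N.-1)%N by rewrite -ht_size nth_last.
have base_gt1 (b : R) : GN R N <= b < N%:R -> 1 < b.
  by case/andP=> Gb _; have /andP[G1 _] := GN_bounds R hN; apply: lt_le_trans Gb.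
have qgP (b : R) a : GN R N <= b < N%:R -> quasi_greedy N b =1 a <-> is_expansion N b a.
  move=> Gb; apply: quasi_greedyP; rewrite (base_gt1 b Gb) /=.
  by apply: ltW; case/andP: Gb.
split; [split|].
- move=> /(admissible_bases R hp ht_size hN t_digits t_last)[bL [bU [GbL GbU eL eU]]].
  by exists bL, bU; split=> //; [apply/(qgP _ _ GbL)|apply/(qgP _ _ GbU)].
- case=> bL [bU [GbL GbU /(qgP _ _ GbL) eL /(qgP _ _ GbU) eU]].
  apply/(admissibleP hp ht_size t_last).
  case/andP: (GbL) => GbL' _; case/andP: (GbU) => GbU' _.
  exact: (expansions_admissible hN hp ht_size t_digits t_last GbL' GbU' eL eU).
move=> bL bU GbL GbU /(qgP _ _ GbL) eL /(qgP _ _ GbU) eU.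
have bL1 := base_gt1 _ GbL; have bU1 := base_gt1 _ GbU.
split.
- exact: (bases_lt hp ht_size (lt_trans ltr01 bL1) eL eU).
- apply: (periodic_base_algebraic hp bL1 eL) => i.
  by rewrite /periodic ht_size modnDl.
- case/andP: GbU => _ bUN; apply: (theta_base_transcendental hp bU1 bUN _ _ eU).
    exact: (theta_le hp ht_size t_digits t_last).
  by move=> m i lti; apply: theta_hi.
Qed.
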